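(* Let $U,V\subset\mathbb{R}^n$ be linear subspaces with $1\le \dim U\le \dim V\le n-1$, $U\neq U\cap V$ and $U\cap V\neq\{0\}$, and let $\theta_F$ be the Friedrichs angle between $U$ and $V$. For $\alpha\in\,]0,1]$ and $\beta\in\,]0,1[$ let $$T_{\alpha,\beta}:=(1-\alpha)I_n+\alpha(2\beta P_V-I_n)(2\beta P_U-I_n).$$ The infimum of the linear convergence rates of the operator $T_{\alpha,\beta}$ attains its smallest value (over all $(\alpha,\beta)\in\,]0,1]\times\,]0,1[$) at $\alpha^\star=1$ and $\beta^\star=\frac{1}{1+\sin\theta_F}$; i.e., it holds $$\frac{1-\sin\theta_F}{1+\sin\theta_F}=\gamma(T_{1,\beta^\star})\le\gamma(T_{\alpha,\beta})\quad\text{for all }(\alpha,\beta)\in\,]0,1]\times\,]0,1[.$$ Furthermore, $\gamma(T_{1,\beta^\star})$ is an optimal linear convergence rate (of $T_{1,\beta^\star}$) if and only if $\theta_F=\frac{\pi}{2}$.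
   Context: The setting is $\mathbb{R}^n$ with the Euclidean inner product and norm. $P_C$ denotes the (orthogonal) projector onto a closed convex set $C$, $C^\perp$ the orthogonal complement, and $I_n$ the $n\times n$ identity. Projectors onto subspaces are identified with their $n\times n$ matrices. $T_{\alpha,\beta}$ is called the AAMR (averaged alternating modified reflections) operator. The Friedrichs angle between $U$ and $V$ is the angle $\theta_F\in\,]0,\frac{\pi}{2}]$ whose cosine is $$c_F(U,V):=\sup\{\langle u,v\rangle : u\in U\cap(U\cap V)^\perp,\ v\in V\cap(U\cap V)^\perp,\ \|u\|\le1,\ \|v\|\le1\}.$$ For a matrix $A\in\mathbb{C}^{n\times n}$ with spectrum (set of eigenvalues) $\sigma(A)$, define $$\gamma(A):=\max\{|\lambda| : \lambda\in\{0\}\cup\sigma(A)\setminus\{1\}\}.$$ With $\|\cdot\|$ the induced matrix norm, $A$ is convergent to $A^\infty\in\mathbb{C}^{n\times n}$ if $\lim_{k\to\infty}\|A^k-A^\infty\|=0$, and linearly convergent to $A^\infty$ with rate $\mu\in[0,1[$ if there exist a positive integer $k_0$ and some $M>0$ such that $\|A^k-A^\infty\|\le M\mu^k$ for all $k\ge k_0$; then $\mu$ is called a linear convergence rate of $A$. When the infimum of all the linear convergence rates of $A$ is itself a linear convergence rate, this minimum is called the optimal linear convergence rate of $A$. *)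

(* Defs.v *)
From mathcomp Require Import all_boot all_order all_algebra.
From mathcomp Require Import complex.
From mathcomp Require Import all_classical all_reals all_analysis.
From mathcomp Require Import lra.

Set Implicit Arguments.
Unset Strict Implicit.
Unset Printing Implicit Defensive.

Import Order.TTheory GRing.Theory Num.Theory.

Local Open Scope classical_set_scope.
Local Open Scope ring_scope.

Section Euclidean.
Variables (R : realType) (n : nat).
Implicit Types (x y : 'cV[R]_n) (U V W : {vspace 'cV[R]_n}) (P : 'M[R]_n).

Definition dotv x y : R := \sum_(i < n) x i 0 * y i 0.

(* The norm [`|x|] that MathComp-Analysis puts on matrices is the sup norm. *)
Definition enorm x : R := Num.sqrt (dotv x x).

Definition orthc W : set 'cV[R]_n :=
  [set x | forall w, w \in W -> dotv x w = 0].

Definition is_projector W P : Prop :=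
  forall x, P *m x \in W /\
    forall w, w \in W -> enorm (x - P *m x) <= enorm (x - w).

(* Existence and uniqueness of the chosen matrix are [projectorP] and
   [is_projector_unique] below. *)
Definition projector W : 'M[R]_n := xget 0 [set P | is_projector W P].

Definition friedrichs_cos U V : R :=
  sup [set r | exists u v,
    [/\ u \in U /\ orthc (U :&: V)%VS u,
        v \in V /\ orthc (U :&: V)%VS v,
        enorm u <= 1, enorm v <= 1 & r = dotv u v]].

(* Since 0 <= c_F < 1, this is the angle of ]0, pi/2] whose cosine is c_F;
   [cos_friedrichs_angle] below proves this for 0 <= c_F <= 1 and the closed
   interval [0, pi/2]. *)
Definition friedrichs_angle U V : R := acos (friedrichs_cos U V).

Definition aamr (alpha beta : R) U V : 'M[R]_n :=
  (1 - alpha) *: 1%:M +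
  alpha *: ((2 * beta *: projector V - 1%:M) *m
            (2 * beta *: projector U - 1%:M)).

End Euclidean.

Section Rates.
Variables (R : realType) (n : nat).
Implicit Types (A : 'M[R[i]]_n) (x : 'cV[R[i]]_n) (mu : R).

Definition cabs (z : R[i]) : R := complex.Re `|z|.

(* The set is finite and nonempty, so that [sup] is the maximum
   (lemma [gamma_max]). *)
Definition gamma A : R :=
  sup [set cabs l | l in [set 0] `|` ([set l | eigenvalue A l] `\ 1)].

Definition cnorm x : R := Num.sqrt (\sum_(i < n) cabs (x i 0) ^+ 2).

(* The set is nonempty and bounded: lemma [opnorm_has_sup]. *)
Definition opnorm A : R := sup [set cnorm (A *m x) | x in [set x | cnorm x <= 1]].

Definition linearly_convergent A Ainf mu : Prop :=
  0 <= mu < 1 /\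
  exists (k0 : nat) (M : R), [/\ (0 < k0)%N, 0 < M &
    forall k : nat, (k0 <= k)%N -> opnorm (A ^+ k - Ainf) <= M * mu ^+ k].

Definition linear_rates A : set R :=
  [set mu | exists Ainf, linearly_convergent A Ainf mu].

Definition optimal_rate A mu : Prop :=
  linear_rates A (inf (linear_rates A)) /\ mu = inf (linear_rates A).

End Rates.

(* gamma and the convergence rates of the real matrix T_{alpha,beta} are those
   of its image in the complex matrices. *)
Definition complexify (R : realType) (n : nat) (A : 'M[R]_n) : 'M[R[i]]_n :=
  map_mx (real_complex R) A.

Section ProjectorFacts.
Variables (R : realType) (n : nat).
Implicit Types (x y z : 'cV[R]_n) (W : {vspace 'cV[R]_n}) (P : 'M[R]_n).

Lemma dotvE x y : dotv x y = (x^T *m y) 0 0.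
Proof. by rewrite mxE; apply: eq_bigr => i _; rewrite mxE. Qed.

Lemma dotvC x y : dotv x y = dotv y x.
Proof. by apply: eq_bigr => i _; rewrite mulrC. Qed.

Lemma dotvDl x y z : dotv (x + y) z = dotv x z + dotv y z.
Proof. by rewrite -big_split; apply: eq_bigr => i _; rewrite mxE mulrDl. Qed.

Lemma dotvZl a x z : dotv (a *: x) z = a * dotv x z.
Proof. by rewrite mulr_sumr; apply: eq_bigr => i _; rewrite mxE mulrA. Qed.

Lemma dotvDr x y z : dotv z (x + y) = dotv z x + dotv z y.
Proof. by rewrite dotvC dotvDl !(dotvC z). Qed.

Lemma dotvZr a x z : dotv z (a *: x) = a * dotv z x.
Proof. by rewrite dotvC dotvZl (dotvC z). Qed.

Lemma dotv_ge0 x : 0 <= dotv x x.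
Proof. by apply: sumr_ge0 => i _; rewrite -expr2 sqr_ge0. Qed.

Lemma dotv_eq0 x : dotv x x = 0 -> x = 0.
Proof.
move=> /eqP; rewrite psumr_eq0; last by move=> i _; rewrite -expr2 sqr_ge0.
move=> /allP x0; apply/matrixP => i j; rewrite (ord1 j) mxE.
by have := x0 i (mem_index_enum i); rewrite /= mulf_eq0 orbb => /eqP.
Qed.

Lemma projector_exists W : exists P, is_projector W P.
Proof.
pose b := vbasis W.
pose B : 'M[R]_(\dim W, n) := \matrix_(i, j) b`_i j 0.
pose G := B *m B^T.
have cB (c : 'rV[R]_(\dim W)) : (c *m B)^T = \sum_i c 0 i *: b`_i.
  apply/matrixP => i j; rewrite (ord1 j) !mxE summxE.
  by apply: eq_bigr => k _; rewrite !mxE.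
have WB (c : 'rV[R]_(\dim W)) : (c *m B)^T \in W.
  rewrite cB; apply: rpred_sum => i _; apply: rpredZ.
  by apply: vbasis_mem; apply: mem_nth; rewrite size_tuple.
have BW w : w \in W -> exists c : 'rV[R]_(\dim W), w = (c *m B)^T.
  move=> /coord_vbasis ->; exists (\row_i coord b i w).
  by rewrite cB; apply: eq_bigr => i _; rewrite mxE.
have Gu : G \in unitmx.
  rewrite -row_free_unit -kermx_eq0; apply/rowV0P => c /sub_kermxP cG.
  have cB0 : (c *m B)^T = 0.
    apply: dotv_eq0.
    by rewrite dotvE trmxK trmx_mul mulmxA -(mulmxA c) cG mul0mx mxE.
  have := basis_free (vbasisP W); move=> /freeP fb.
  by apply/rowP => i; rewrite mxE; apply: fb; rewrite -cB.
exists (B^T *m invmx G *m B) => x.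
set p := _ *m x.
have pW : p \in W.
  have := WB (invmx G *m B *m x)^T.
  by rewrite trmx_mul trmxK !mulmxA.
split=> // w wW; rewrite /enorm ler_sqrt ?dotv_ge0//.
have orth u : u \in W -> dotv u (x - p) = 0.
  move=> /BW[c ->]; rewrite dotvE trmxK mulmxBr /p !mulmxA.
  by rewrite -(mulmxA c B B^T) -/G -(mulmxA c G) mulmxV// mulmx1 subrr mxE.
have -> : x - w = (p - w) + (x - p) by rewrite [RHS]addrC addrA subrK.
have d0 : dotv (p - w) (x - p) = 0 by apply: orth; rewrite rpredB.
move: (p - w) (x - p) d0 => a d d0.
rewrite dotvDl !dotvDr d0 (dotvC d) d0 addr0 add0r.
by rewrite lerDr dotv_ge0.
Qed.

Lemma projectorP W : is_projector W (projector W).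
Proof.
rewrite /projector; case: xgetP => [P _ //|noP].
by have [P PP] := projector_exists W; case: (noP P).
Qed.

Lemma is_projector_orth W P x : is_projector W P -> orthc W (x - P *m x).
Proof.
move=> /(_ x)[PW minP] w wW.
set r := x - P *m x in minP *; have [ww0|ww0] := eqVneq (dotv w w) 0.
  rewrite (dotv_eq0 ww0); rewrite /dotv big1// => i _.
  by rewrite [X in _ * X]mxE mulr0.
have wwp : 0 < dotv w w by rewrite lt_def ww0 dotv_ge0.
pose t := dotv r w / dotv w w.
have := minP (P *m x + t *: w) (rpredD PW (rpredZ t wW)).
rewrite /enorm ler_sqrt ?dotv_ge0//.
have -> : x - (P *m x + t *: w) = r + (- t) *: w.
  by rewrite scaleNr opprD addrA.
clear minP; clearbody r.
rewrite dotvDl !dotvDr !dotvZl !dotvZr (dotvC w r) -addrA lerDl.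
have -> : - t * dotv r w + (- t * dotv r w + - t * (- t * dotv w w)) =
          - (dotv r w ^+ 2 / dotv w w).
  rewrite /t !mulNr mulrN opprK !mulrA mulfVK// expr2.
  by rewrite (mulrAC _ (dotv w w)^-1 (dotv r w)) addNr addr0.
rewrite oppr_ge0 pmulr_lle0 ?invr_gt0// => r2.
by apply/eqP; rewrite -sqrf_eq0 eq_le r2 sqr_ge0.
Qed.

Lemma is_projector_unique W P Q :
  is_projector W P -> is_projector W Q -> P = Q.
Proof.
move=> hP hQ; suff PQ x : P *m x = Q *m x.
  apply/matrixP => i j.
  have := PQ (delta_mx j 0); rewrite -!colE => /matrixP/(_ i 0).
  by rewrite !mxE.
apply/subr0_eq/dotv_eq0.
have dW : P *m x - Q *m x \in W.
  by rewrite rpredB//; [case: (hP x)|case: (hQ x)].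
rewrite {1}(_ : P *m x - Q *m x = (x - Q *m x) + (- 1) *: (x - P *m x)).
  rewrite dotvDl dotvZl (is_projector_orth x hP dW) (is_projector_orth x hQ dW).
  by rewrite mulr0 addr0.
by rewrite scaleN1r opprB [RHS]addrC addrA subrK.
Qed.

Lemma friedrichs_has_sup (U V : {vspace 'cV[R]_n}) :
  has_sup [set r | exists u v,
    [/\ u \in U /\ orthc (U :&: V)%VS u,
        v \in V /\ orthc (U :&: V)%VS v,
        enorm u <= 1, enorm v <= 1 & r = dotv u v]].
Proof.
have d0 z : dotv 0 z = 0 by rewrite /dotv big1// => i _; rewrite mxE mul0r.
split.
  exists 0, 0, 0; rewrite !mem0v /enorm d0 sqrtr0 ler01.
  by split=> //; split=> // w _; rewrite d0.
exists 1 => _ [u [v [_ _ u1 v1 ->]]].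
have sq z : enorm z <= 1 -> dotv z z <= 1.
  by rewrite /enorm -{1}sqrtr1 ler_sqrt ?ler01.
have := dotv_ge0 (u + (- 1) *: v).
rewrite dotvDl !dotvDr !dotvZl !dotvZr (dotvC v u).
by have := sq _ u1; have := sq _ v1; lra.
Qed.

Lemma cos_friedrichs_angle (U V : {vspace 'cV[R]_n}) :
  0 <= friedrichs_angle U V <= pi / 2 /\
  cos (friedrichs_angle U V) = friedrichs_cos U V.
Proof.
have [_ ub] := friedrichs_has_sup U V.
have d0 z : dotv 0 z = 0 by rewrite /dotv big1// => i _; rewrite mxE mul0r.
have c0 : 0 <= friedrichs_cos U V.
  apply: ub_le_sup => //; exists 0, 0; rewrite !mem0v /enorm d0 sqrtr0 ler01.
  by split=> //; split=> // w _; rewrite d0.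
have c1 : friedrichs_cos U V <= 1.
  apply: ge_sup; first by case: (friedrichs_has_sup U V).
  move=> _ [u [v [_ _ u1 v1 ->]]].
  have sq z : enorm z <= 1 -> dotv z z <= 1.
    by rewrite /enorm -{1}sqrtr1 ler_sqrt ?ler01.
  have := dotv_ge0 (u + (- 1) *: v).
  rewrite dotvDl !dotvDr !dotvZl !dotvZr (dotvC v u).
  by have := sq _ u1; have := sq _ v1; lra.
have c11 : -1 <= friedrichs_cos U V <= 1 by rewrite c1 andbT; lra.
have cK := acosK c11.
split=> //; rewrite acos_ge0//= leNgt; apply/negP => lt.
have := acos_lepi c11; rewrite -/(friedrichs_angle U V) => le_pi.
have : cos (friedrichs_angle U V) < 0.
  rewrite -cos_pihalf ltr_cos// in_itv/= ?acos_ge0//; have := pi_gt0 R; lra.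
by rewrite cK ltNge c0.
Qed.

End ProjectorFacts.

Section RatesFacts.
Variables (R : realType) (n : nat).
Implicit Types (A : 'M[R[i]]_n).

Lemma gamma_max A :
  (exists2 l, l = 0 \/ (eigenvalue A l /\ l <> 1) & gamma A = cabs l) /\
  (forall l, l = 0 \/ (eigenvalue A l /\ l <> 1) -> cabs l <= gamma A).
Proof.
have [rs rsE] := closed_field_poly_normal (char_poly A).
have rsP l : eigenvalue A l = (l \in rs).
  rewrite eigenvalue_root_char rsE (eqP (char_poly_monic A)) scale1r.
  by rewrite root_prod_XsubC.
have maxs (s : seq R[i]) x0 : exists2 m, m \in x0 :: s &
    forall l, l \in x0 :: s -> cabs l <= cabs m.
  elim: s x0 => [|y s IH] x0.
    by exists x0 => [|l]; rewrite inE // => /eqP ->.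
  have [m ms mP] := IH y; have [le|lt] := leP (cabs x0) (cabs m).
    exists m => [|l]; first by rewrite inE ms orbT.
    by rewrite inE => /orP[/eqP ->//|]; exact: mP.
  exists x0 => [|l]; first by rewrite inE eqxx.
  rewrite inE => /orP[/eqP ->//|/mP] lm; exact: le_trans lm (ltW lt).
have [m ms mP] := maxs [seq l <- rs | l != 1] 0.
have memP l : l \in 0 :: [seq l <- rs | l != 1] <->
    l = 0 \/ (eigenvalue A l /\ l <> 1).
  rewrite inE mem_filter rsP; split.
    by case/orP=> [/eqP|/andP[/eqP]]; [left|right].
  by case=> [->|[-> /eqP ->]]; rewrite ?eqxx ?orbT.
have gE : gamma A = cabs m.
  apply/eqP; rewrite eq_le; apply/andP; split.
    apply: ge_sup; first by exists (cabs 0), 0 => //; left.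
    by move=> _ [l lA <-]; apply/mP/memP; case: lA => [->|[? ?]]; [left|right].
  apply: ub_le_sup.
    exists (cabs m) => _ [l lA <-].
    by apply/mP/memP; case: lA => [->|[? ?]]; [left|right].
  by exists m => //; case/memP: ms => [->|[? ?]]; [left|right].
by split; [exists m => //; exact/memP|move=> l /memP; rewrite gE; exact: mP].
Qed.

Lemma cabsE (z : R[i]) : (cabs z)%:C%C = `|z|.
Proof. by rewrite /cabs normc_def. Qed.

Lemma opnorm_has_sup A :
  has_sup [set cnorm (A *m x) | x in [set x | cnorm x <= 1]].
Proof.
have cabs_ge0 z : 0 <= @cabs R z by rewrite /cabs normc_def /= sqrtr_ge0.
split.
  exists (cnorm (A *m 0)), 0 => //=; rewrite /cnorm big1 ?sqrtr0 ?ler01// => i _.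
  by rewrite mxE /cabs normr0 expr0n.
exists (Num.sqrt (\sum_(i < n) (\sum_(j < n) cabs (A i j)) ^+ 2)).
move=> _ [x x1 <-]; rewrite /cnorm.
have xj j : cabs (x j 0) <= 1.
  rewrite -(@ler_pXn2r _ 2)// ?nnegrE// expr1n.
  move: x1; rewrite /= /cnorm -{1}sqrtr1 ler_sqrt ?ler01//; apply: le_trans.
  by rewrite (bigD1 j)//= lerDl sumr_ge0// => k _; rewrite sqr_ge0.
rewrite ler_sqrt; last by apply: sumr_ge0 => i _; rewrite sqr_ge0.
apply: ler_sum => i _; rewrite ler_pXn2r ?nnegrE// ?sumr_ge0//.
rewrite -lecR cabsE mxE; apply: le_trans (ler_norm_sum _ _ _) _.
rewrite rmorph_sum /=; apply: ler_sum => j _.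
rewrite cabsE normrM ler_piMr// -cabsE.
by have := xj j; rewrite -lecR.
Qed.

End RatesFacts.

(* Main.v *)
From mathcomp Require Import all_boot all_order all_algebra.
From mathcomp Require Import complex.
From mathcomp Require Import all_classical all_reals all_analysis.
From mathcomp Require Import ring lra.
Require Import Defs.
Import Order.TTheory GRing.Theory Num.Theory.
Local Open Scope classical_set_scope.
Local Open Scope ring_scope.
Set Implicit Arguments.
Unset Strict Implicit.
Unset Printing Implicit Defensive.

(** Write P, Q, W for the projectors onto U, V and their intersection, c for
the Friedrichs cosine, s for the sine of the Friedrichs angle, d = 2b - 1 and
D = (P - Q)^2.  The case alpha = 1 is governed by one identity
([reflections_quad]): R = (2bQ - 1)(2bP - 1) satisfies
  R^2 + d^2 = (1 + d^2) R - 4 b^2 R D.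
It replaces the decomposition of the space by principal angles.  If x is an
eigenvector of R with eigenvalue z <> 0, the identity makes x an eigenvector of
D, with an eigenvalue r for which
  z^2 - (1 + d^2 - 4 b^2 r) z + d^2 = 0.
Both D and 1 - D = (1 - P - Q)^2 are squares of symmetric matrices, so r is
real and lies in [0, 1] ([reflections_eigenvalue]); the Friedrichs angle is the
smallest nonzero principal angle, so r = 0 or r >= s^2
([sqdiff_spectral_gap]).  For r = 0 the roots are 1 and d^2.  For r > 0 they are
in the open unit disc, and if b = 1/(1+s) the discriminant is nonpositive for
all r in [s^2, 1], so both roots have modulus d = (1-s)/(1+s); this bounds
gamma at the optimum from above ([aamr_opt_gamma_le]).

For the lower bound, c is the largest singular value of PQ - W and is attained
when it is positive ([friedrichs_vector]).  The corresponding pair of principal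
vectors spans a plane invariant under R, in which the quadratic above with
r = s^2 is the characteristic polynomial.  One of its roots z gives the
eigenvalue 1 - alpha + alpha z of T_{alpha,beta}, and the two lemmas
[opt_le_real_root] and [opt_le_complex_root] show that its modulus is at least
(1-s)/(1+s).

Rates are tied to gamma by [inf_linear_rates]: if 1 is a semisimple eigenvalue
(or no eigenvalue) of A and gamma A < 1, then the infimum of the linear rates of
A is gamma A.  The identity above gives the semisimplicity
([reflections_semisimple]).  Whether the infimum is attained at the optimum is
decided in the same plane: if c > 0 its double eigenvalue (1-s)/(1+s) carries a
Jordan block, whose powers grow like k m^k ([jordan_block_not_rate]); if c = 0
the projectors commute and the optimal operator is idempotent, hence has rate
0. *)

(** * Algebra of two idempotents *)

Section TwoProjections.
Variables (F : fieldType) (n : nat) (P Q : 'M[F]_n).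
Hypotheses (PP : P *m P = P) (QQ : Q *m Q = Q).

(** The operator T_{1,b}; the identities below use only that P and Q are
idempotent. *)
Definition reflections (b : F) : 'M[F]_n :=
  (2 * b *: Q - 1%:M) *m (2 * b *: P - 1%:M).

(** For orthogonal projectors the eigenvalues of this matrix are the squared
sines of the principal angles between the two ranges, possibly together
with 0 and 1. *)
Definition sqdiff : 'M[F]_n := (P - Q) *m (P - Q).

Lemma reflectionsE b : reflections b =
  4 * b ^+ 2 *: (Q *m P) - 2 * b *: Q - 2 * b *: P + 1%:M.
Proof.
rewrite /reflections mulmxBl !mulmxBr -!scalemxAl -!scalemxAr mulmx1 !mul1mx.
by apply/matrixP => i j; rewrite !mxE; ring.
Qed.

Lemma sqdiffE : sqdiff = P + Q - P *m Q - Q *m P.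
Proof.
rewrite /sqdiff mulmxBl !mulmxBr PP QQ.
by apply/matrixP => i j; rewrite !mxE; ring.
Qed.

(** If y is an eigenvector of the squared difference, this relation makes P y
an eigenvector of P Q P. *)
Lemma mul_proj_sqdiff : P *m sqdiff = P - P *m Q *m P.
Proof.
rewrite sqdiffE !mulmxBr mulmxDr !mulmxA PP.
by apply/matrixP => i j; rewrite !mxE; ring.
Qed.

(** The complement is again a square, which for symmetric P and Q bounds the
eigenvalues of the squared difference by 1. *)
Lemma sqdiff_compl :
  1%:M - sqdiff = (1%:M - P - Q) *m (1%:M - P - Q).
Proof.
rewrite sqdiffE !mulmxBl !mulmxBr !mulmx1 !mul1mx PP QQ.
by apply/matrixP => i j; rewrite !mxE; ring.
Qed.

(** Both A = 2bP - 1 and B = 2bQ - 1 are quadratic, with constant term -d, so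
A and A' = A + 2 - 2b multiply to d.  Hence A'B' is the adjugate of BA: their
product is d^2, and their sum, which plays the role of a trace, is
1 + d^2 - 4 b^2 D.  This is Cayley-Hamilton for all principal planes at
once. *)
Lemma reflections_quad b : let d := 2 * b - 1 in
  reflections b *m reflections b + d ^+ 2 *: 1%:M =
  (1 + d ^+ 2) *: reflections b
    - 4 * b ^+ 2 *: (reflections b *m sqdiff).
Proof.
move=> d.
pose A := 2 * b *: P - 1%:M; pose B := 2 * b *: Q - 1%:M.
pose A' := A + (2 - 2 * b) *: 1%:M; pose B' := B + (2 - 2 * b) *: 1%:M.
have AA' : A *m A' = d *: 1%:M.
  rewrite /A' /A mulmxDr mulmxBl !mulmxBr -!scalemxAr !mulmx1 -!scalemxAl.
  rewrite !mul1mx PP.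
  by apply/matrixP => i j; rewrite !mxE /d; ring.
have BB' : B *m B' = d *: 1%:M.
  rewrite /B' /B mulmxDr mulmxBl !mulmxBr -!scalemxAr !mulmx1 -!scalemxAl.
  rewrite !mul1mx QQ.
  by apply/matrixP => i j; rewrite !mxE /d; ring.
have trE : B *m A + A' *m B' =
    (1 + d ^+ 2) *: 1%:M - 4 * b ^+ 2 *: sqdiff.
  rewrite sqdiffE /A' /B' /A /B !(mulmxDl, mulmxDr, mulmxN, mulNmx).
  rewrite -!scalemxAl -!scalemxAr !mulmx1 !mul1mx.
  by apply/matrixP => i j; rewrite !mxE /d; ring.
have -> : reflections b = B *m A by [].
transitivity (B *m A *m (B *m A + A' *m B')).
  rewrite mulmxDr; congr (_ + _).
  by rewrite mulmxA -(mulmxA B) AA' -scalemxAr mulmx1 -scalemxAl BB' scalerA.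
by rewrite trE mulmxBr -!scalemxAr mulmx1.
Qed.

(** Rows u and v span a principal plane: v lies in the range of Q, u = v P, and
k is the squared cosine of the angle.  The plane is invariant under the
operator, whose matrix in the basis (u, v) has trace 4 b^2 k - 2 d and
determinant d^2. *)
Section Block.
Variables (k : F) (u v : 'rV[F]_n) (b : F).
Hypotheses (uP : u *m P = u) (uQ : u *m Q = k *: v).
Hypotheses (vP : v *m P = u) (vQ : v *m Q = v).
Local Notation d := (2 * b - 1).

Lemma block_u : u *m reflections b =
  (4 * b ^+ 2 * k - d) *: u - 2 * b * k *: v.
Proof.
rewrite reflectionsE !(mulmxDr, mulmxN) -!scalemxAr mulmxA mulmx1 uP uQ.
rewrite -scalemxAl vP.
by apply/matrixP => i j; rewrite !mxE; ring.
Qed.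

Lemma block_v : v *m reflections b = 2 * b * d *: u - d *: v.
Proof.
rewrite reflectionsE !(mulmxDr, mulmxN) -!scalemxAr mulmxA mulmx1 vP vQ vP.
by apply/matrixP => i j; rewrite !mxE; ring.
Qed.

(** Applying P and Q gives x + y = 0 and x k + y = 0. *)
Lemma block_free x y : v != 0 -> k != 0 -> k != 1 ->
  x *: u + y *: v = 0 -> x = 0 /\ y = 0.
Proof.
move=> v0 k0 k1 e0.
have u0 : u != 0.
  apply/eqP => u0; move/eqP: uQ; rewrite u0 mul0mx eq_sym scaler_eq0.
  by rewrite (negPf k0) (negPf v0).
have := congr1 (mulmx^~ P) e0; have := congr1 (mulmx^~ Q) e0.
rewrite /= !mul0mx !mulmxDl -!scalemxAl uP uQ vP vQ scalerA -!scalerDl.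
move=> /eqP; rewrite scaler_eq0 (negPf v0) orbF => /eqP e1.
move=> /eqP; rewrite scaler_eq0 (negPf u0) orbF => /eqP e2.
have : x * (k - 1) = 0 by rewrite -[RHS]subr0 -{1}e1 -e2; ring.
move=> /eqP; rewrite mulf_eq0 subr_eq0 (negPf k1) orbF => /eqP x0.
by move: e2; rewrite x0 add0r.
Qed.

Lemma block_eigen z : b != 0 -> (2 : F) != 0 -> v != 0 -> k != 0 -> k != 1 ->
  z ^+ 2 - (4 * b ^+ 2 * k - 2 * d) * z + d ^+ 2 = 0 ->
  exists2 x : 'rV[F]_n, x *m reflections b = z *: x & x != 0.
Proof.
move=> b0 two0 v0 k0 k1 zE; exists ((z + d) *: u - 2 * b * k *: v).
  rewrite mulmxBl -!scalemxAl block_u block_v.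
  apply/matrixP => i j; rewrite !mxE.
  apply/eqP; rewrite -subr_eq0; apply/eqP.
  (* The difference of the two sides is the characteristic polynomial at z,
     times - u. *)
  rewrite -[RHS](mul0r (- u i j)) -{1}zE; ring.
apply/eqP; rewrite -scaleNr => /block_free[]// _ /eqP.
by rewrite oppr_eq0 !mulf_eq0 (negPf two0) (negPf b0) (negPf k0).
Qed.

(** The vector u (R - d), which becomes an eigenvector in [block_jordan]. *)
Lemma block_generalized_neq0 : v != 0 -> k != 0 -> k != 1 -> 2 * d != 0 ->
  2 * d *: u - 2 * b * k *: v != 0.
Proof.
move=> v0 k0 k1 d0; apply/eqP; rewrite -scaleNr => /block_free[]// /eqP.
by rewrite (negPf d0).
Qed.

(** The condition b^2 k = d says that the trace of the block is 2 d, so that d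
is a double eigenvalue; it holds for k = 1 - s^2 and b = 1 / (1 + s). *)
Lemma block_jordan : b ^+ 2 * k = d ->
  let w := 2 * d *: u - 2 * b * k *: v in
  u *m reflections b = d *: u + w /\ w *m reflections b = d *: w.
Proof.
move=> bk w; split.
  by rewrite block_u -mulrA bk; apply/matrixP => i j; rewrite !mxE; ring.
rewrite mulmxBl -!scalemxAl block_u block_v -[4 * _ * k]mulrA bk.
have -> : 2 * b * k *: (2 * b * d *: u - d *: v) =
    4 * (b ^+ 2 * k) * d *: u - 2 * b * k * d *: v.
  by apply/matrixP => i j; rewrite !mxE; ring.
by rewrite bk; apply/matrixP => i j; rewrite !mxE; ring.
Qed.

End Block.
End TwoProjections.

(** * Modulus and entrywise norm *)

Section ComplexModulus.
Variable R : realType.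
Implicit Types (z w : R[i]) (r : R).

Lemma cabs_ge0 z : 0 <= cabs z.
Proof. by rewrite -lecR cabsE normr_ge0. Qed.

Lemma cabs_real r : cabs r%:C%C = `|r|.
Proof. by rewrite /cabs normc_def /= expr0n /= addr0 sqrtr_sqr. Qed.

Lemma cabs0 : cabs (0 : R[i]) = 0.
Proof. by rewrite (cabs_real 0) normr0. Qed.

Lemma cabsM z w : cabs (z * w) = cabs z * cabs w.
Proof. exact: Normc.normcM. Qed.

Lemma cabsD z w : cabs (z + w) <= cabs z + cabs w.
Proof. exact: le_normcD. Qed.

Lemma cabs0_eq0 z : cabs z = 0 -> z = 0.
Proof. exact: Normc.eq0_normc. Qed.

Lemma cabs_sqr (x y : R) : cabs (Complex x y) ^+ 2 = x ^+ 2 + y ^+ 2.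
Proof. by rewrite /cabs normc_def sqr_sqrtr// addr_ge0 ?sqr_ge0. Qed.

Lemma cabsX z k : cabs (z ^+ k) = cabs z ^+ k.
Proof.
elim: k => [|k IH]; first by rewrite !expr0 (cabs_real 1) normr1.
by rewrite !exprS cabsM IH.
Qed.

End ComplexModulus.

Section EntrywiseNorm.
Variable R : realType.

(** The sum of moduli is equivalent to the operator norm, which enters linear
convergence only up to a constant factor; it is subadditive and
submultiplicative by direct computation, for rectangular matrices too. *)
Definition norm1 m n (A : 'M[R[i]]_(m, n)) : R := \sum_i \sum_j cabs (A i j).

Lemma norm1_ge0 m n (A : 'M[R[i]]_(m, n)) : 0 <= norm1 A.
Proof. by do 2! apply: sumr_ge0 => ? _; exact: cabs_ge0. Qed.

Lemma norm1_eq0 m n (A : 'M[R[i]]_(m, n)) : norm1 A = 0 -> A = 0.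
Proof.
have ge0 i : 0 <= \sum_j cabs (A i j).
  by apply: sumr_ge0 => j _; exact: cabs_ge0.
move=> /eqP; rewrite psumr_eq0// => /allP A0; apply/matrixP => i j.
have := A0 i (mem_index_enum i).
rewrite /= psumr_eq0 => [|k _]; last exact: cabs_ge0.
by move=> /allP/(_ j (mem_index_enum j))/eqP/cabs0_eq0; rewrite mxE.
Qed.

Lemma norm1D m n (A B : 'M[R[i]]_(m, n)) : norm1 (A + B) <= norm1 A + norm1 B.
Proof.
rewrite /norm1 -big_split /=; apply: ler_sum => i _.
by rewrite -big_split /=; apply: ler_sum => j _; rewrite mxE cabsD.
Qed.

Lemma norm1Z m n z (A : 'M[R[i]]_(m, n)) : norm1 (z *: A) = cabs z * norm1 A.
Proof.
rewrite /norm1 mulr_sumr; apply: eq_bigr => i _.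
by rewrite mulr_sumr; apply: eq_bigr => j _; rewrite mxE cabsM.
Qed.

Lemma norm1N m n (A : 'M[R[i]]_(m, n)) : norm1 (- A) = norm1 A.
Proof.
have N1 : -1 = (-1)%:C%C :> R[i] by rewrite rmorphN rmorph1.
by rewrite -scaleN1r norm1Z N1 cabs_real normrN1 mul1r.
Qed.

Lemma norm1B m n (A B : 'M[R[i]]_(m, n)) : norm1 (A - B) <= norm1 A + norm1 B.
Proof. by rewrite -(norm1N B) norm1D. Qed.

Lemma cabs_sum (I : Type) (s : seq I) (F : I -> R[i]) :
  cabs (\sum_(i <- s) F i) <= \sum_(i <- s) cabs (F i).
Proof.
elim/big_rec2: _ => [|i y z _ le]; first by rewrite cabs0.
by apply: le_trans (cabsD _ _) _; rewrite lerD2l.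
Qed.

Lemma norm1M m n p (A : 'M[R[i]]_(m, n)) (B : 'M[R[i]]_(n, p)) :
  norm1 (A *m B) <= norm1 A * norm1 B.
Proof.
rewrite /norm1 mulr_suml; apply: ler_sum => i _.
apply: (@le_trans _ _ (\sum_k \sum_j cabs (A i j) * cabs (B j k))).
  apply: ler_sum => k _; rewrite mxE; apply: le_trans (cabs_sum _ _) _.
  by apply: ler_sum => j _; rewrite cabsM.
rewrite exchange_big mulr_suml; apply: ler_sum => j _.
rewrite -mulr_sumr ler_wpM2l ?cabs_ge0// (bigD1 j)//= lerDl.
by do 2! apply: sumr_ge0 => ? _; exact: cabs_ge0.
Qed.

Variable n : nat.
Implicit Types A : 'M[R[i]]_n.

(** Test the operator norm on the j-th basis vector. *)
Lemma cabs_le_opnorm A i j : cabs (A i j) <= opnorm A.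
Proof.
have dE k : (delta_mx j 0 : 'cV[R[i]]_n) k 0 = (k == j)%:R.
  by rewrite mxE eqxx andbT.
have [_ ub] := opnorm_has_sup A.
apply: (@le_trans _ _ (cnorm (A *m delta_mx j 0))); last first.
  apply: ub_le_sup => //; exists (delta_mx j 0) => //=.
  rewrite /cnorm (bigD1 j)//= dE eqxx (cabs_real 1) normr1 expr1n big1 ?addr0.
    by rewrite sqrtr1.
  by move=> k /negPf kj; rewrite dE kj cabs0 expr0n.
rewrite /cnorm -[leLHS]ger0_norm ?cabs_ge0// -sqrtr_sqr ler_sqrt; last first.
  by apply: sumr_ge0 => k _; rewrite sqr_ge0.
rewrite (bigD1 i)//= -colE mxE lerDl.
by apply: sumr_ge0 => k _; rewrite sqr_ge0.
Qed.

Lemma norm1_le_opnorm A : norm1 A <= opnorm A *+ (n * n).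
Proof.
apply: (@le_trans _ _ (\sum_(i < n) \sum_(j < n) opnorm A)).
  by do 2! apply: ler_sum => ? _; exact: cabs_le_opnorm.
by rewrite !sumr_const card_ord mulrnA.
Qed.

Lemma opnorm_le_norm1 A : opnorm A <= norm1 A.
Proof.
apply: ge_sup; first by case: (opnorm_has_sup A).
move=> _ [x x1 <-].
have xj j : cabs (x j 0) <= 1.
  rewrite -(@ler_pXn2r _ 2)// ?nnegrE// ?cabs_ge0// expr1n.
  move: x1; rewrite /= /cnorm -{1}sqrtr1 ler_sqrt ?ler01//; apply: le_trans.
  by rewrite (bigD1 j)//= lerDl sumr_ge0// => k _; rewrite sqr_ge0.
set y := A *m x.
have S0 : 0 <= \sum_i cabs (y i 0) by apply: sumr_ge0 => i _; exact: cabs_ge0.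
apply: (@le_trans _ _ (\sum_i cabs (y i 0))).
  rewrite /cnorm -[leRHS]ger0_norm// -sqrtr_sqr ler_sqrt ?sqr_ge0//.
  rewrite expr2 mulr_suml; apply: ler_sum => i _.
  rewrite expr2 ler_wpM2l ?cabs_ge0// (bigD1 i)//= lerDl.
  by apply: sumr_ge0 => k _; exact: cabs_ge0.
apply: ler_sum => i _; rewrite mxE; apply: le_trans (cabs_sum _ _) _.
by apply: ler_sum => j _; rewrite cabsM ler_piMr ?cabs_ge0.
Qed.

Lemma opnorm0 : opnorm (0 : 'M[R[i]]_n) = 0.
Proof.
apply/eqP; rewrite eq_le; apply/andP; split.
  apply: le_trans (opnorm_le_norm1 0) _.
  by rewrite /norm1 big1// => i _; rewrite big1// => j _; rewrite mxE cabs0.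
have [[y y0] ub] := opnorm_has_sup (0 : 'M[R[i]]_n).
apply: le_trans (ub_le_sup ub y0).
by case: y0 => x _ <-; exact: sqrtr_ge0.
Qed.

End EntrywiseNorm.

(** * Linear rates and the subdominant eigenvalues *)

Section LinearRates.
Variables (R : realType) (n : nat).
Implicit Types (A : 'M[R[i]]_n.+1) (mu : R) (z : R[i]).

(** The generalized eigenspace for 1 is the eigenspace; matrices for which 1 is
not an eigenvalue qualify. *)
Definition semisimple_at1 A := forall y : 'rV[R[i]]_n.+1,
  y *m (A - 1) *m (A - 1) = 0 -> y *m (A - 1) = 0.

(** Induction on the list of roots: removing the root z replaces Y by
Y (A - z), whose decay is known, and Y A^(k+1) = z Y A^k + Y (A - z) A^k is a
linear recurrence with |z| < mu and a forcing term of order mu^k. *)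
Lemma power_decay A (s : seq R[i]) mu (Y : 'M[R[i]]_n.+1) :
  0 < mu -> (forall z, z \in s -> cabs z < mu) ->
  Y * horner_mx A (\prod_(z <- s) ('X - z%:P)) = 0 ->
  exists M, forall k, norm1 (Y * A ^+ k) <= M * mu ^+ k.
Proof.
move=> mu0; elim: s Y => [|z s IH] Y zs.
  rewrite big_nil rmorph1 mulr1 => ->; exists 0 => k.
  by rewrite mul0r mul0r -(scale0r 0) norm1Z cabs0 mul0r.
rewrite big_cons rmorphM mulrA => /IH[].
  by move=> w ws; apply: zs; rewrite inE ws orbT.
move=> M YM; have zmu : cabs z < mu by apply: zs; rewrite inE eqxx.
have Bmu : 0 < mu - cabs z by rewrite subr_gt0.
(* The constant K must dominate the initial value and satisfy
   |z| K + M <= mu K. *)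
exists (Num.max (norm1 Y) (M / (mu - cabs z))).
set K := Num.max _ _; elim=> [|k IHk].
  by rewrite !expr0 !mulr1 le_max lexx.
have -> : Y * A ^+ k.+1 = z *: (Y * A ^+ k)
    + Y * horner_mx A ('X - z%:P) * A ^+ k.
  rewrite rmorphB /= horner_mx_X horner_mx_C mulrBr mulrBl exprS mulrA.
  by rewrite -(scalemx1 _ z) -scalerAr mulr1 -scalerAl addrC subrK.
apply: le_trans (norm1D _ _) _; rewrite norm1Z.
apply: (@le_trans _ _ (cabs z * (K * mu ^+ k) + (mu - cabs z) * K * mu ^+ k)).
  apply: lerD; first by rewrite ler_wpM2l ?cabs_ge0.
  apply: le_trans (YM k) _; rewrite ler_wpM2r ?exprn_ge0 ?(ltW mu0)//.
  by rewrite mulrC -ler_pdivrMr// le_max lexx orbT.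
by rewrite exprS; lra.
Qed.

Lemma linear_rate_norm1 A (L : 'M[R[i]]_n.+1) mu M : 0 <= mu < 1 ->
  (forall k, norm1 (A ^+ k - L) <= M * mu ^+ k) -> linear_rates A mu.
Proof.
move=> mu01 AL; exists L; split=> //; exists 1%N, (`|M| + 1); split=> //.
move=> k _; apply: le_trans (opnorm_le_norm1 _) _; apply: le_trans (AL k) _.
rewrite ler_wpM2r ?exprn_ge0//; first by case/andP: mu01.
by have := ler_norm M; lra.
Qed.

(** Comparing consecutive powers eliminates the unknown limit. *)
Lemma linear_rate_step A mu : linear_rates A mu ->
  exists k0 M, forall k, (k0 <= k)%N ->
    norm1 (A ^+ k.+1 - A ^+ k) <= M * mu ^+ k.
Proof.
move=> [L [/andP[mu0 mu1] [k0 [M [_ M0 AL]]]]].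
exists k0, ((M * mu) *+ (n.+1 * n.+1) + M *+ (n.+1 * n.+1)) => k kk0.
have bnd j : (k0 <= j)%N ->
    norm1 (A ^+ j - L) <= (M * mu ^+ j) *+ (n.+1 * n.+1).
  move=> /AL jM; apply: le_trans (norm1_le_opnorm _) _.
  by rewrite lerMn2r jM orbT.
have -> : A ^+ k.+1 - A ^+ k = (A ^+ k.+1 - L) - (A ^+ k - L).
  by rewrite opprB addrA subrK.
apply: le_trans (norm1B _ _) _.
rewrite mulrDl lerD ?mulrnAl -?mulrA -?exprS//; last exact: bnd.
by apply: bnd; exact: leq_trans kk0 _.
Qed.

Lemma le_of_geometric_le (a b M : R) k0 : 0 <= a -> 0 <= b ->
  (forall k, (k0 <= k)%N -> a ^+ k <= M * b ^+ k) -> a <= b.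
Proof.
move=> a0 b0 ab; rewrite leNgt; apply/negP => ba.
have a_gt0 : 0 < a by exact: le_lt_trans b0 ba.
have ba1 : `|b / a| < 1 by rewrite ger0_norm ?divr_ge0// ltr_pdivrMr// mul1r.
have /cvgrPdist_lt/(_ 1 ltr01)[N _ /(_ (maxn N k0))] := cvg_geometric M ba1.
rewrite /= leq_maxl => /(_ isT); rewrite sub0r normrN ltNge => /negP; apply.
apply: le_trans (ler_norm _).
rewrite /geometric /= expr_div_n mulrA ler_pdivlMr ?exprn_gt0// mul1r.
by apply: ab; exact: leq_maxr.
Qed.

(** On an eigenvector x the consecutive difference is z^k (z - 1) x, and z - 1
does not vanish. *)
Lemma eigenvalue_le_rate A mu z : linear_rates A mu ->
  eigenvalue A z -> z <> 1 -> cabs z <= mu.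
Proof.
move=> ratemu /eigenvalueP[x xA x0] z1.
have mu0 : 0 <= mu by case: ratemu => L [/andP[]].
have [k0 [M AM]] := linear_rate_step ratemu.
have xAk k : x *m A ^+ k = z ^+ k *: x.
  elim: k => [|k IH]; first by rewrite !expr0 mulmx1 scale1r.
  by rewrite exprSr mulmxA IH -scalemxAl xA scalerA exprSr.
have Nx : 0 < norm1 x.
  rewrite lt_neqAle norm1_ge0 andbT eq_sym.
  by apply: contraNN x0 => /eqP/norm1_eq0 ->.
have Nz : 0 < cabs (z - 1).
  rewrite lt_neqAle cabs_ge0 andbT eq_sym; apply/eqP => /cabs0_eq0/eqP.
  by rewrite subr_eq0 => /eqP.
apply: (@le_of_geometric_le _ _ (M / cabs (z - 1)) k0); rewrite ?cabs_ge0//.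
move=> k kk0; rewrite mulrAC ler_pdivlMr// -cabsX -cabsM -(ler_pM2r Nx).
rewrite -norm1Z [leRHS]mulrC.
have -> : (z ^+ k * (z - 1)) *: x = x *m (A ^+ k.+1 - A ^+ k).
  by rewrite mulmxBr !xAk -scalerBl mulrBr mulr1 exprSr.
apply: le_trans (norm1M _ _) _.
by rewrite ler_wpM2l ?AM// ltW.
Qed.

Lemma gamma_le_rate A mu : linear_rates A mu -> gamma A <= mu.
Proof.
move=> ratemu; have [[z zA ->] _] := gamma_max A.
case: zA => [->|[zA z1]]; last exact: eigenvalue_le_rate ratemu zA z1.
by rewrite cabs0; case: ratemu => L [/andP[]].
Qed.

(** Write the characteristic polynomial as (X - 1)^a q with q(1) <> 0.
Cayley-Hamilton and semisimplicity give (A - 1) q(A) = 0, so L = q(A) / q(1)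
is fixed by A and is the limit.  Since 1 - q / q(1) vanishes at 1, the factor
1 - L is a multiple of A - 1, hence annihilated by q(A), and [power_decay]
applies to A^k - L = (1 - L) A^k. *)
Lemma linear_rates_gt_gamma A mu : semisimple_at1 A -> gamma A < mu < 1 ->
  linear_rates A mu.
Proof.
move=> ssA /andP[gmu mu1]; have [_ gA] := gamma_max A.
have mu0 : 0 < mu.
  by apply: le_lt_trans gmu; rewrite -(@cabs0 R); apply: gA; left.
have [rs rsE] := closed_field_poly_normal (char_poly A).
rewrite (eqP (char_poly_monic A)) scale1r in rsE.
have rsP z : z \in rs -> eigenvalue A z.
  by rewrite eigenvalue_root_char rsE root_prod_XsubC.
pose s := [seq z <- rs | z != 1].
pose q : {poly R[i]} := \prod_(z <- s) ('X - z%:P).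
have smu z : z \in s -> cabs z < mu.
  rewrite mem_filter => /andP[/eqP z1 /rsP zA].
  by apply: le_lt_trans gmu; apply: gA; right.
have charE : char_poly A = ('X - 1%:P) ^+ (count_mem 1 rs) * q.
  rewrite rsE /q big_filter (bigID (pred1 1))/= -big_filter.
  congr (_ * _); rewrite big_filter.
  rewrite (eq_bigr (fun=> 'X - 1%:P)) => [|z /eqP -> //].
  by rewrite big_const_seq iter_mulr_1.
have Xsub1 : horner_mx A ('X - 1%:P) = A - 1.
  by rewrite rmorphB /= horner_mx_X horner_mx_C.
have qA1 : (A - 1) * horner_mx A q = 0.
  have qcomm : (A - 1) * horner_mx A q = horner_mx A q * (A - 1).
    by rewrite -Xsub1 -!rmorphM mulrC.
  have := Cayley_Hamilton A; rewrite charE rmorphM rmorphXn /= Xsub1.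
  have -> : (A - 1) ^+ count_mem 1 rs * horner_mx A q =
      horner_mx A q * (A - 1) ^+ count_mem 1 rs.
    by apply: commr_sym; apply: commrX; exact: esym qcomm.
  rewrite qcomm; elim: (count_mem _ _) => [|a IHa].
    by rewrite expr0 mulr1 => ->; rewrite mul0r.
  case: a IHa => [|a] IHa; first by rewrite expr1.
  rewrite !exprSr !mulrA => qa; apply: IHa; rewrite exprSr mulrA.
  apply/row_matrixP => i; rewrite row_mul [RHS]linear0; apply: ssA.
  by rewrite -!row_mul [X in row i X]qa linear0.
have q1 : q.[1] != 0.
  rewrite -[q.[1] == 0]/(root q 1) root_prod_XsubC mem_filter.
  by rewrite eqxx.
pose L := q.[1]^-1 *: horner_mx A q.
have AL k : A ^+ k * L = L.
  elim: k => [|k IH]; first by rewrite expr0 mul1r.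
  rewrite exprSr -mulrA; suff -> : A * L = L by [].
  apply/eqP; rewrite -subr_eq0 -[X in _ - X]mul1r -mulrBl /L -scalerAr.
  by rewrite qA1 scaler0.
have [|M LM] := @power_decay A s mu (1 - L) mu0 smu.
  have /factor_theorem[r rE] : root (1 - q.[1]^-1 *: q) 1.
    by rewrite /root hornerD hornerN hornerZ hornerC mulVf// subrr eqxx.
  have -> : 1 - L = horner_mx A (r * ('X - 1%:P)).
    rewrite -rE rmorphB rmorph1 -mul_polyC rmorphM /= horner_mx_C.
    by rewrite -scalemx1 -scalerAl mul1r.
  by rewrite rmorphM /= -mulrA Xsub1 qA1 mulr0.
apply: (@linear_rate_norm1 A L mu M) => [|k]; first by rewrite ltW.
apply: le_trans (LM k).
suff -> : A ^+ k - L = (1 - L) * A ^+ k by [].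
rewrite mulrBl mul1r; congr (_ - _); rewrite -{1}(AL k) /L -scalerAl -scalerAr.
congr (_ *: _).
by apply/esym/commrX; rewrite /GRing.comm -{2 3}(horner_mx_X A) -!rmorphM mulrC.
Qed.

Lemma inf_linear_rates A : semisimple_at1 A -> gamma A < 1 ->
  linear_rates A !=set0 /\ inf (linear_rates A) = gamma A.
Proof.
move=> ssA gA1.
have ne : linear_rates A !=set0.
  exists ((gamma A + 1) / 2); apply: linear_rates_gt_gamma => //.
  by apply/andP; lra.
split=> //; apply/eqP; rewrite eq_le; apply/andP; split; last first.
  by apply: lb_le_inf => // mu; exact: gamma_le_rate.
rewrite leNgt; apply/negP => lt.
pose mu := Num.min ((gamma A + 1) / 2) ((gamma A + inf (linear_rates A)) / 2).
have : inf (linear_rates A) <= mu.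
  apply: ge_inf; first by exists (gamma A) => x; exact: gamma_le_rate.
  apply: linear_rates_gt_gamma => //; rewrite /mu lt_min gt_min.
  by apply/andP; split; [apply/andP|apply/orP; left]; lra.
rewrite leNgt => /negP; apply; rewrite /mu gt_min; apply/orP; right; lra.
Qed.

(** Here u A^k = m^k u + k m^(k-1) w.  The consecutive differences on u thus
contain the term k m^(k-1) w (A - 1), which is not O(m^k). *)
Lemma jordan_block_not_rate A (u w : 'rV[R[i]]_n.+1) (m : R) : 0 < m < 1 ->
  w != 0 -> u *m A = m%:C%C *: u + w -> w *m A = m%:C%C *: w ->
  ~ linear_rates A m.
Proof.
move=> /andP[m0 m1] w0 uA wA /linear_rate_step[k0 [M AM]].
have uAk k : u *m A ^+ k.+1 =
    (m ^+ k.+1)%:C%C *: u + ((m ^+ k) *+ k.+1)%:C%C *: w.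
  elim: k => [|k IH]; first by rewrite !expr1 uA rmorph1 scale1r.
  rewrite exprSr mulmxA IH mulmxDl -!scalemxAl uA wA scalerDr !scalerA -!rmorphM.
  rewrite -addrA -scalerDl -rmorphD -exprSr mulrnAl -exprSr.
  by rewrite [in RHS]mulrS.
have cabs_ge r : 0 <= r -> cabs (r%:C%C : R[i]) = r.
  by move=> r0; rewrite cabs_real ger0_norm.
pose u' := u *m (A - 1); pose w' := w *m (A - 1).
have Nw' : 0 < norm1 w'.
  rewrite lt_neqAle norm1_ge0 andbT eq_sym; apply: contraNN w0 => /eqP/norm1_eq0.
  rewrite /w' mulmxBr wA mulmx1 -{2}(scale1r w) -scalerBl => /eqP.
  rewrite scaler_eq0 subr_eq0 -(rmorph1 (real_complex R)) (inj_eq (@complexI R)).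
  by rewrite lt_eqF.
have bound k : (k0 <= k)%N ->
    k.+1%:R * norm1 w' <= m * (norm1 u * M + norm1 u').
  move=> kk0; rewrite -(ler_pM2l (exprn_gt0 k m0)).
  have -> : m ^+ k * (k.+1%:R * norm1 w') =
      norm1 (((m ^+ k) *+ k.+1)%:C%C *: w').
    by rewrite norm1Z cabs_ge ?mulrn_wge0 ?exprn_ge0 ?(ltW m0)// mulrA mulr_natr.
  have -> : ((m ^+ k) *+ k.+1)%:C%C *: w' =
      u *m (A ^+ k.+2 - A ^+ k.+1) - (m ^+ k.+1)%:C%C *: u'.
    have -> : A ^+ k.+2 - A ^+ k.+1 = A ^+ k.+1 *m (A - 1).
      by rewrite mulmxBr mulmx1 exprSr.
    by rewrite mulmxA uAk mulmxDl -!scalemxAl addrC addKr.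
  apply: le_trans (norm1B _ _) _.
  rewrite norm1Z cabs_ge ?exprn_ge0 ?(ltW m0)// mulrA -exprSr mulrDr lerD2r.
  apply: le_trans (norm1M _ _) _; rewrite [leRHS]mulrCA ler_wpM2l ?norm1_ge0//.
  by rewrite mulrC; apply: AM; exact: leq_trans kk0 _.
pose C := m * (norm1 u * M + norm1 u').
have := bound (maxn k0 (Num.bound `|C / norm1 w'|)) (leq_maxl _ _).
rewrite -/C -ler_pdivlMr//; apply/negP; rewrite -ltNge.
apply: le_lt_trans (ler_norm _) _.
apply: lt_le_trans (archi_boundP (normr_ge0 _)) _.
by rewrite ler_nat (leq_trans (leq_maxr k0 _)).
Qed.

End LinearRates.

(** * Largest singular values *)

Section Coercivity.
Variables (R : realType) (n : nat).
Implicit Types (x y : 'cV[R]_n) (M G N : 'M[R]_n).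

Lemma dotv_mulmxl M x y : dotv (M *m x) y = dotv x (M^T *m y).
Proof. by rewrite !dotvE trmx_mul mulmxA. Qed.

Lemma dotvNl x y : dotv (- x) y = - dotv x y.
Proof. by rewrite -scaleN1r dotvZl mulN1r. Qed.

Lemma dotvNr x y : dotv x (- y) = - dotv x y.
Proof. by rewrite dotvC dotvNl dotvC. Qed.

Lemma dotv_ext x y : (forall z, dotv z x = dotv z y) -> x = y.
Proof.
move=> xy; apply/subr0_eq/dotv_eq0.
by rewrite dotvDr dotvNr xy subrr.
Qed.

Lemma enorm_sqr x : enorm x ^+ 2 = dotv x x.
Proof. by rewrite sqr_sqrtr ?dotv_ge0. Qed.

Lemma enorm_ge0 x : 0 <= enorm x.
Proof. exact: sqrtr_ge0. Qed.

Lemma enorm_gt0 x : x <> 0 -> 0 < enorm x.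
Proof.
move=> x0; rewrite lt_neqAle enorm_ge0 andbT eq_sym -sqrf_eq0 enorm_sqr.
by apply/eqP => /dotv_eq0.
Qed.

Lemma dotv_gt0 x : x != 0 -> 0 < dotv x x.
Proof. by move=> /eqP x0; rewrite -enorm_sqr exprn_gt0 ?enorm_gt0. Qed.

Lemma discriminant_le (a b c : R) : 0 <= c ->
  (forall t, 0 <= a + 2 * t * b + t ^+ 2 * c) -> b ^+ 2 <= a * c.
Proof.
move=> c0 qge0; have [c_eq0|c_neq0] := eqVneq c 0.
  have [->|b0] := eqVneq b 0; first by rewrite c_eq0 mulr0 expr0n.
  have := qge0 (- (a + 1) / (2 * b)).
  have -> : 2 * (- (a + 1) / (2 * b)) * b = - (a + 1) by field; rewrite b0.
  by rewrite c_eq0; lra.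
have c_gt0 : 0 < c by rewrite lt_def c_neq0.
have := qge0 (- b / c).
have -> : a + 2 * (- b / c) * b + (- b / c) ^+ 2 * c = (a * c - b ^+ 2) / c.
  by field.
by rewrite pmulr_lge0 ?invr_gt0// subr_ge0.
Qed.

(** The discriminant of the nonnegative quadratic t |-> form at x + t y. *)
Lemma psd_CauchySchwarz M x y : M^T = M ->
  (forall z, 0 <= dotv z (M *m z)) ->
  dotv x (M *m y) ^+ 2 <= dotv x (M *m x) * dotv y (M *m y).
Proof.
move=> MT Mge0; apply: discriminant_le => // t.
have := Mge0 (x + t *: y).
rewrite mulmxDr -scalemxAr dotvDr !dotvDl dotvZr !dotvZl dotvZr.
have -> : dotv y (M *m x) = dotv x (M *m y) by rewrite dotvC dotv_mulmxl MT.
by congr (0 <= _); ring.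
Qed.

Lemma dotv_CauchySchwarz x y : dotv x y ^+ 2 <= dotv x x * dotv y y.
Proof.
have := @psd_CauchySchwarz 1%:M x y (trmx1 _ _); rewrite !mul1mx; apply.
by move=> z; rewrite mul1mx dotv_ge0.
Qed.

Lemma dotv_le_enorm x y : dotv x y <= enorm x * enorm y.
Proof.
apply: le_trans (ler_norm _) _; rewrite -(@ler_pXn2r _ 2)// ?nnegrE//.
  by rewrite real_normK ?num_real// exprMn !enorm_sqr dotv_CauchySchwarz.
by rewrite mulr_ge0 ?enorm_ge0.
Qed.

Lemma quadratic_form_bounded N :
  exists2 K, 0 < K & forall x, dotv x (N *m x) <= K * dotv x x.
Proof.
exists (1 + \sum_i \sum_j `|N i j|) => [|x].
  by rewrite ltr_pwDl// sumr_ge0// => i _; rewrite sumr_ge0.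
have xi i : x i 0 ^+ 2 <= dotv x x.
  rewrite /dotv (bigD1 i)//= expr2 lerDl.
  by apply: sumr_ge0 => j _; rewrite -expr2 sqr_ge0.
apply: (@le_trans _ _ ((\sum_i \sum_j `|N i j|) * dotv x x)); last first.
  by rewrite ler_wpM2r ?dotv_ge0// lerDr.
rewrite [in leLHS]/dotv mulr_suml; apply: ler_sum => i _.
rewrite mxE mulr_sumr mulr_suml; apply: ler_sum => j _.
rewrite mulrCA; apply: le_trans (ler_norm _) _; rewrite normrM.
rewrite ler_wpM2l// normrM.
have := xi i; have := xi j; rewrite -!(real_normK (num_real (x _ _))).
by have := sqr_ge0 (`|x i 0| - `|x j 0|); nra.
Qed.

(** Without compactness: M = c^2 - G^T G is positive semidefinite.  If it were
invertible, Cauchy-Schwarz for M applied to x and M^-1 x would give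
|x|^4 <= (x, M x) (x, M^-1 x), hence |x|^2 <= K (x, M x) for some K, and
c^2 - 1/K would be a better bound than c^2. *)
Lemma singular_value_attained G c : 0 < c ->
  (forall x, dotv (G *m x) (G *m x) <= c ^+ 2 * dotv x x) ->
  (forall e, 0 <= e ->
    (forall x, dotv (G *m x) (G *m x) <= e * dotv x x) -> c ^+ 2 <= e) ->
  exists2 v : 'cV[R]_n, v != 0 & G^T *m (G *m v) = c ^+ 2 *: v.
Proof.
move=> c0 Gc Gleast; pose M := (c ^+ 2)%:M - G^T *m G.
have MT : M^T = M by rewrite linearB /= tr_scalar_mx trmx_mul trmxK.
have ME x : dotv x (M *m x) = c ^+ 2 * dotv x x - dotv (G *m x) (G *m x).
  rewrite mulmxBl mul_scalar_mx dotvDr dotvZr dotvNr dotv_mulmxl.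
  by rewrite mulmxA.
have Mge0 x : 0 <= dotv x (M *m x) by rewrite ME subr_ge0.
have [Mu|Mnu] := boolP (M \in unitmx); last first.
  have [w w0 wM] : exists2 w : 'rV[R]_n, w != 0 & w *m M = 0.
    move: Mnu; rewrite -row_free_unit -kermx_eq0 => /rowV0Pn[w].
    by move=> /sub_kermxP ? ?; exists w.
  exists w^T.
    by apply: contraNN w0 => /eqP w0; rewrite -(trmxK w) w0 trmx0.
  apply/esym/subr0_eq; rewrite mulmxA -mul_scalar_mx -mulmxBl -/M.
  by rewrite -MT -trmx_mul wM trmx0.
have [K K0 NK] := quadratic_form_bounded (invmx M).
have coercive x : dotv x x <= K * dotv x (M *m x).
  have [->|x0] := eqVneq x 0; first by rewrite mulmx0 dotvE mulmx0 mxE mulr0.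
  have xx0 := dotv_gt0 x0; rewrite -(ler_pM2r xx0).
  have := psd_CauchySchwarz x (invmx M *m x) MT Mge0.
  rewrite mulKVmx// (dotvC _ x) => /le_trans; rewrite expr2; apply.
  rewrite mulrAC (mulrC (dotv x _)) ler_wpM2r//; exact: NK.
have : c ^+ 2 <= Num.max 0 (c ^+ 2 - K^-1).
  apply: Gleast => [|x]; first by rewrite le_max lexx.
  apply: (@le_trans _ _ ((c ^+ 2 - K^-1) * dotv x x)); last first.
    by rewrite ler_wpM2r ?dotv_ge0// le_max lexx orbT.
  have := coercive x; rewrite ME mulrC -ler_pdivrMr// mulrC mulrBl; lra.
rewrite leNgt gt_max exprn_gt0//= ltrBlDr ltrDl invr_gt0 K0.
by [].
Qed.

End Coercivity.

(** * Orthogonal projectors *)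

Section OrthogonalProjectors.
Variables (R : realType) (n : nat).
Implicit Types (x y : 'cV[R]_n) (U V W : {vspace 'cV[R]_n}).

Lemma mulmx_projector_in W x : projector W *m x \in W.
Proof. by case: (projectorP W x). Qed.

Lemma projector_id W x : x \in W -> projector W *m x = x.
Proof.
move=> xW; apply/esym/subr0_eq/dotv_eq0.
by apply: (is_projector_orth x (projectorP W)); rewrite rpredB ?mulmx_projector_in.
Qed.

Lemma dotv_projector W x y : y \in W -> dotv (projector W *m x) y = dotv x y.
Proof.
move=> yW; apply/eqP; rewrite eq_sym -subr_eq0 -dotvNl -dotvDl; apply/eqP.
exact: (is_projector_orth x (projectorP W)).
Qed.

Lemma mulmx_ext (A B : 'M[R]_n) : (forall x, A *m x = B *m x) -> A = B.
Proof.
move=> AB; apply/matrixP => i j.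
by have /matrixP/(_ i 0) := AB (delta_mx j 0); rewrite -!colE !mxE.
Qed.

Lemma projector_sym W : (projector W)^T = projector W.
Proof.
apply: mulmx_ext => x; apply: dotv_ext => z; rewrite -dotv_mulmxl dotvC.
rewrite -(dotv_projector x (mulmx_projector_in W z)) dotvC.
by rewrite dotv_projector ?mulmx_projector_in.
Qed.

Lemma projectorM_sub W U : (W <= U)%VS ->
  projector U *m projector W = projector W.
Proof.
move=> /subvP WU; apply: mulmx_ext => x; rewrite -mulmxA projector_id//.
by apply: WU; exact: mulmx_projector_in.
Qed.

Lemma projectorM_sup W U : (W <= U)%VS ->
  projector W *m projector U = projector W.
Proof.
move=> WU; apply: trmx_inj.
by rewrite trmx_mul !projector_sym projectorM_sub.
Qed.

Lemma projector_idem W : projector W *m projector W = projector W.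
Proof. exact: projectorM_sub. Qed.

Lemma projector0 W x : orthc W x -> projector W *m x = 0.
Proof.
move=> xW; apply: dotv_eq0.
by rewrite dotv_projector ?mulmx_projector_in// xW ?mulmx_projector_in.
Qed.

End OrthogonalProjectors.

(** * The Friedrichs angle *)

(** Since P - W and Q - W are the projectors onto the two subspaces in the
definition of the Friedrichs cosine c, and (P - W)(Q - W) = P Q - W, the number
c is the operator norm of P Q - W. *)

Section Friedrichs.
Variables (R : realType) (n : nat) (U V : {vspace 'cV[R]_n}).
Implicit Types x y u v : 'cV[R]_n.
Local Notation P := (projector U).
Local Notation Q := (projector V).
Local Notation W := (projector (U :&: V)%VS).
Local Notation c := (friedrichs_cos U V).
Local Notation G := (P *m Q - W).

Let PP : P *m P = P. Proof. exact: projector_idem. Qed.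
Let QQ : Q *m Q = Q. Proof. exact: projector_idem. Qed.
Let WW : W *m W = W. Proof. exact: projector_idem. Qed.
Let PW : P *m W = W. Proof. exact/projectorM_sub/capvSl. Qed.
Let WP : W *m P = W. Proof. exact/projectorM_sup/capvSl. Qed.
Let QW : Q *m W = W. Proof. exact/projectorM_sub/capvSr. Qed.
Let WQ : W *m Q = W. Proof. exact/projectorM_sup/capvSr. Qed.

Lemma friedrichs_cos_ge0 : 0 <= c.
Proof.
have [[r [u [v [uU vV u1 v1 _]]]] ub] := friedrichs_has_sup U V.
have d0 z : dotv 0 z = 0 :> R by rewrite -[0](scale0r z) dotvZl mul0r.
apply: ub_le_sup => //; exists 0, v; split=> //; rewrite ?d0//.
- by split; [exact: mem0v|move=> w _; exact: d0].
- by rewrite /enorm d0 sqrtr0 ler01.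
Qed.

Lemma dotv_le_friedrichs u v :
  u \in U -> orthc (U :&: V)%VS u -> v \in V -> orthc (U :&: V)%VS v ->
  dotv u v <= c * (enorm u * enorm v).
Proof.
move=> uU uo vV vo.
have [->|/eqP u0] := eqVneq u 0.
  by rewrite -[0](scale0r v) dotvZl mul0r !mulr_ge0 ?friedrichs_cos_ge0 ?enorm_ge0.
have [->|/eqP v0] := eqVneq v 0.
  by rewrite -[0](scale0r u) dotvZr mul0r !mulr_ge0 ?friedrichs_cos_ge0 ?enorm_ge0.
have nu := enorm_gt0 u0; have nv := enorm_gt0 v0.
rewrite -ler_pdivrMr ?mulr_gt0//.
have orthZ a x : orthc (U :&: V)%VS x -> orthc (U :&: V)%VS (a *: x).
  by move=> xo w wW; rewrite dotvZl xo// mulr0.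
have unit x : 0 < enorm x -> enorm ((enorm x)^-1 *: x) <= 1.
  move=> nx; rewrite -(@ler_pXn2r _ 2)// ?nnegrE ?enorm_ge0// expr1n.
  rewrite enorm_sqr dotvZl dotvZr -enorm_sqr mulrA -expr2 -exprMn.
  by rewrite mulVf ?expr1n// gt_eqF.
apply: ub_le_sup; first by case: (friedrichs_has_sup U V).
exists ((enorm u)^-1 *: u), ((enorm v)^-1 *: v).
split; rewrite ?unit//; try by split; rewrite ?rpredZ//; exact: orthZ.
by rewrite dotvZl dotvZr invfM; ring.
Qed.

Let GE : G = (P - W) *m (Q - W).
Proof.
by rewrite mulmxBl !mulmxBr PW WQ WW subrr subr0.
Qed.

Lemma enorm_projB_le W' U' x : (W' <= U')%VS ->
  enorm ((projector U' - projector W') *m x) <= enorm x.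
Proof.
move=> WU; set Pi := projector U' - projector W'.
have PiT : Pi^T = Pi by rewrite linearB /= !projector_sym.
have PiPi : Pi *m Pi = Pi.
  rewrite mulmxBl !mulmxBr !projector_idem projectorM_sub// projectorM_sup//.
  by rewrite subrr subr0.
have := dotv_le_enorm x (Pi *m x).
have -> : dotv x (Pi *m x) = enorm (Pi *m x) * enorm (Pi *m x).
  by rewrite -expr2 enorm_sqr dotv_mulmxl PiT mulmxA PiPi.
have [->|n0] := eqVneq (enorm (Pi *m x)) 0; first by rewrite enorm_ge0.
by rewrite ler_pM2r// lt_def n0 enorm_ge0.
Qed.

Lemma projB_orthc W' U' x : (W' <= U')%VS ->
  orthc W' ((projector U' - projector W') *m x).
Proof.
move=> /subvP WU w wW; rewrite mulmxBl dotvDl dotvNl !dotv_projector//.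
  by rewrite subrr.
exact: WU.
Qed.

Lemma projB_in W' U' x : (W' <= U')%VS ->
  (projector U' - projector W') *m x \in U'.
Proof.
move=> /subvP WU; rewrite mulmxBl rpredB ?mulmx_projector_in//.
by apply: WU; exact: mulmx_projector_in.
Qed.

Let GT : G^T = Q *m P - W.
Proof. by rewrite linearB /= trmx_mul !projector_sym. Qed.

Lemma friedrichs_norm x : dotv (G *m x) (G *m x) <= c ^+ 2 * dotv x x.
Proof.
rewrite -!enorm_sqr -exprMn ler_pXn2r ?nnegrE ?mulr_ge0 ?enorm_ge0//.
  2: exact: friedrichs_cos_ge0.
have [->|n0] := eqVneq (enorm (G *m x)) 0.
  by rewrite mulr_ge0 ?friedrichs_cos_ge0 ?enorm_ge0.
have n_gt0 : 0 < enorm (G *m x) by rewrite lt_def n0 enorm_ge0.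
rewrite -(ler_pM2l n_gt0) -expr2 enorm_sqr.
have -> : dotv (G *m x) (G *m x) = dotv ((P - W) *m (G *m x)) ((Q - W) *m x).
  rewrite [RHS]dotv_mulmxl linearB /= !projector_sym.
  by rewrite {2}GE !mulmxA.
apply: le_trans (dotv_le_friedrichs _ _ _ _) _; rewrite ?projB_in ?capvSl ?capvSr//;
  try by apply: projB_orthc; rewrite ?capvSl ?capvSr.
rewrite [leRHS]mulrCA ler_wpM2l ?friedrichs_cos_ge0//.
by rewrite ler_pM ?enorm_ge0// enorm_projB_le// ?capvSl ?capvSr.
Qed.

Lemma friedrichs_norm_tr x : dotv (G^T *m x) (G^T *m x) <= c ^+ 2 * dotv x x.
Proof.
rewrite -!enorm_sqr -exprMn ler_pXn2r ?nnegrE ?mulr_ge0 ?enorm_ge0//.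
  2: exact: friedrichs_cos_ge0.
have [->|n0] := eqVneq (enorm (G^T *m x)) 0.
  by rewrite mulr_ge0 ?friedrichs_cos_ge0 ?enorm_ge0.
have n_gt0 : 0 < enorm (G^T *m x) by rewrite lt_def n0 enorm_ge0.
rewrite -(ler_pM2r n_gt0) -expr2 enorm_sqr dotv_mulmxl trmxK.
apply: le_trans (dotv_le_enorm _ _) _.
rewrite mulrAC [leRHS]mulrC ler_wpM2l ?enorm_ge0//.
rewrite -(@ler_pXn2r _ 2)// ?nnegrE ?mulr_ge0 ?friedrichs_cos_ge0 ?enorm_ge0//.
by rewrite exprMn !enorm_sqr friedrichs_norm.
Qed.

Lemma friedrichs_norm_least e : 0 <= e ->
  (forall x, dotv (G *m x) (G *m x) <= e * dotv x x) -> c ^+ 2 <= e.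
Proof.
move=> e0 Ge; rewrite -(sqr_sqrtr e0) ler_pXn2r ?nnegrE ?sqrtr_ge0//.
  2: exact: friedrichs_cos_ge0.
apply: ge_sup; first by case: (friedrichs_has_sup U V).
move=> _ [u [v [[uU _] [vV vo] u1 v1 ->]]].
have -> : dotv u v = dotv u (G *m v).
  rewrite mulmxBl -mulmxA (projector_id vV) (projector0 vo) subr0.
  by rewrite dotvC -(dotv_projector v uU) dotvC.
apply: le_trans (dotv_le_enorm _ _) _.
apply: (@le_trans _ _ (enorm (G *m v))); first by rewrite ler_piMl ?enorm_ge0.
rewrite ler_sqrt//; apply: le_trans (Ge v) _.
rewrite ler_piMr// -enorm_sqr.
by rewrite -(expr1n _ 2) ler_pXn2r ?nnegrE ?enorm_ge0.
Qed.

(** The singular vector v satisfies Q P Q v - W v = c^2 v; applying Q and W to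
this equation gives the other two properties. *)
Lemma friedrichs_vector : 0 < c ->
  exists v, [/\ v != 0, Q *m v = v, W *m v = 0 & Q *m P *m v = c ^+ 2 *: v].
Proof.
move=> c0.
have [v v0 Gv] :=
  singular_value_attained c0 friedrichs_norm friedrichs_norm_least.
have cc0 : c ^+ 2 != 0 by rewrite expf_neq0// gt_eqF.
have GG : G^T *m G = Q *m P *m Q - W.
  rewrite GT mulmxBl !mulmxBr WW !mulmxA -(mulmxA Q P P) PP.
  by rewrite -(mulmxA Q P W) PW QW WP WQ subrr subr0.
rewrite mulmxA GG in Gv.
have Qv : Q *m v = v.
  by apply: (scalerI cc0); rewrite scalemxAr -Gv mulmxA mulmxBr !mulmxA QQ QW.
have Wv : W *m v = 0.
  apply: (scalerI cc0); rewrite scaler0 scalemxAr -Gv mulmxA mulmxBr !mulmxA.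
  by rewrite WQ WP WQ WW subrr mul0mx.
exists v; split=> //.
by rewrite -Gv mulmxBl Wv subr0 -[RHS]mulmxA Qv.
Qed.

(** If c = 1 the singular vector v would satisfy |P v| = |v|, so it would lie in
U and V, and W v = 0 would force v = 0. *)
Lemma friedrichs_cos_lt1 : c < 1.
Proof.
rewrite ltNge; apply/negP => c1.
have c0 : 0 < c by apply: lt_le_trans c1.
have [v [v0 Qv Wv QPv]] := friedrichs_vector c0.
have ee : dotv (P *m v) (P *m v) = c ^+ 2 * dotv v v.
  rewrite dotv_mulmxl projector_sym mulmxA PP -{1}Qv dotv_mulmxl projector_sym.
  by rewrite mulmxA QPv dotvZr.
have Pv : P *m v = v.
  apply/subr0_eq/dotv_eq0/eqP; rewrite eq_le dotv_ge0 andbT.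
  rewrite dotvDl !dotvDr !dotvNl !dotvNr (dotvC v).
  have -> : dotv (P *m v) v = dotv (P *m v) (P *m v).
    by rewrite -{1}PP -mulmxA dotv_mulmxl projector_sym.
  rewrite ee; have := dotv_gt0 v0.
  have : 1 <= c ^+ 2 by rewrite -(expr1n _ 2) ler_pXn2r ?nnegrE// ltW.
  by nra.
have vUV : v \in (U :&: V)%VS.
  by rewrite memv_cap -{1}Pv -{2}Qv !mulmx_projector_in.
by move: v0; rewrite -(projector_id vUV) Wv eqxx.
Qed.

Lemma mul_projectors_orthogonal : c = 0 -> P *m Q = W.
Proof.
move=> c0; apply/subr0_eq/mulmx_ext => x; rewrite mul0mx; apply: dotv_eq0.
apply/eqP; rewrite eq_le dotv_ge0 andbT.
by have := friedrichs_norm x; rewrite c0 expr0n mul0r.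
Qed.

(** If D y = r y then u = P y satisfies P Q u = (1 - r) u, and r <> 0 forces
W u = 0.  Hence |(P Q - W)^T u|^2 = (1 - r) |u|^2, at most c^2 |u|^2.  The same
argument applies to Q y, and P y and Q y cannot both vanish. *)
Lemma sqdiff_spectral_gap y (s : R) : y != 0 -> s != 0 ->
  sqdiff P Q *m y = s *: y -> 1 - c ^+ 2 <= s.
Proof.
move=> y0 s0 yD; have [s1|s1] := leP 1 s.
  by have := sqr_ge0 c; lra.
suff : 1 - s <= c ^+ 2 by lra.
have s1' : 0 < 1 - s by lra.
have W0 A B (x : 'cV[R]_n) : W *m A = W -> W *m B = W -> A *m x = x ->
    A *m B *m x = (1 - s) *: x -> W *m x = 0.
  move=> WA WB Ax ABx; apply: (scalerI s0); rewrite scaler0.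
  have := congr1 (mulmx W) ABx; rewrite !mulmxA WA WB -scalemxAr.
  by rewrite scalerBl scale1r => /eqP; rewrite eq_sym subr_eq addrC -subr_eq
    subrr eq_sym => /eqP.
have [Py0|Py0] := eqVneq (P *m y) 0; last first.
  set u := P *m y in Py0.
  have Pu : P *m u = u by rewrite mulmxA PP.
  have PQu : P *m Q *m u = (1 - s) *: u.
    have := congr1 (mulmx P) yD; rewrite mulmxA mul_proj_sqdiff// mulmxBl.
    rewrite -(mulmxA (P *m Q)) -/u -scalemxAr -/u scalerBl scale1r => <-.
    by rewrite opprB addrC subrK.
  have Wu := W0 _ _ _ WP WQ Pu PQu.
  have := friedrichs_norm_tr u.
  rewrite GT mulmxBl -mulmxA Pu Wu subr0 dotv_mulmxl projector_sym mulmxA QQ.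
  rewrite -{1}Pu dotv_mulmxl projector_sym mulmxA PQu dotvZr.
  by rewrite ler_pM2r ?dotv_gt0.
have [Qy0|Qy0] := eqVneq (Q *m y) 0.
  move: yD; rewrite /sqdiff -mulmxA (mulmxBl P Q y) Py0 Qy0 subr0 mulmx0.
  move=> /esym/eqP.
  by rewrite scaler_eq0 (negPf s0) (negPf y0).
set v := Q *m y in Qy0.
have Qv : Q *m v = v by rewrite mulmxA QQ.
have QPv : Q *m P *m v = (1 - s) *: v.
  have := congr1 (mulmx Q) yD; rewrite mulmxA.
  have -> : sqdiff P Q = sqdiff Q P.
    by rewrite /sqdiff -opprB mulNmx mulmxN opprK.
  rewrite mul_proj_sqdiff// mulmxBl.
  rewrite -(mulmxA (Q *m P)) -/v -scalemxAr -/v scalerBl scale1r => <-.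
  by rewrite opprB addrC subrK.
have Wv := W0 _ _ _ WQ WP Qv QPv.
have := friedrichs_norm v.
rewrite mulmxBl -mulmxA Qv Wv subr0 dotv_mulmxl projector_sym mulmxA PP.
rewrite -{1}Qv dotv_mulmxl projector_sym mulmxA QPv dotvZr.
by rewrite ler_pM2r ?dotv_gt0.
Qed.

End Friedrichs.

(** * Complex eigenvectors of real symmetric matrices *)

Section HermitianSquares.
Variables (R : realType) (n : nat).
Local Notation toC := (map_mx (real_complex R)).
Implicit Types (x y : 'rV[R[i]]_n) (E D : 'M[R]_n).

Definition hnorm2 x : R[i] := (x *m (map_mx (@conjc R) x)^T) 0 0.

Lemma hnorm2_ge0 x : 0 <= hnorm2 x.
Proof. by rewrite /hnorm2 mxE; apply: sumr_ge0 => i _; rewrite !mxE mulcJ_ge0. Qed.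

Lemma hnorm2_eq0 x : hnorm2 x = 0 -> x = 0.
Proof.
rewrite /hnorm2 mxE => /eqP; rewrite psumr_eq0; last first.
  by move=> i _; rewrite !mxE mulcJ_ge0.
move=> /allP x0; apply/matrixP => i j; rewrite (ord1 i) [RHS]mxE.
have := x0 j (mem_index_enum j); rewrite /= !mxE -sqr_normc.
by rewrite sqrf_eq0 normr_eq0 => /eqP.
Qed.

(** A real symmetric matrix is its own adjoint. *)
Lemma hnorm2_symmetric E x : E^T = E ->
  hnorm2 (x *m toC E) = (x *m toC E *m toC E *m (map_mx (@conjc R) x)^T) 0 0.
Proof.
move=> ET; rewrite /hnorm2 map_mxM trmx_mul mulmxA; congr ((_ *m _ *m _) 0 0).
apply/matrixP => i j; rewrite !mxE -{1}ET mxE; exact: conjc_real.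
Qed.

Lemma symmetric_square_eigenvalue E x (l : R[i]) : E^T = E -> x != 0 ->
  x *m toC (E *m E) = l *: x -> exists2 s : R, 0 <= s & l = s%:C%C.
Proof.
move=> ET x0; rewrite map_mxM mulmxA => xEE.
have := hnorm2_ge0 (x *m toC E).
rewrite hnorm2_symmetric// xEE -scalemxAl mxE -/(hnorm2 x) => l0.
have hx : 0 < hnorm2 x.
  rewrite lt_def hnorm2_ge0 andbT.
  by apply: contraNN x0 => /eqP/hnorm2_eq0 ->.
rewrite pmulr_lge0// in l0; exists (complex.Re l).
  by move: l0; rewrite lecE /= => /andP[].
case: l l0 {xEE} => a b; rewrite lecE /= => /andP[/eqP -> _].
by [].
Qed.

Lemma symmetric_square_kernel E x : E^T = E ->
  x *m toC E *m toC E = 0 -> x *m toC E = 0.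
Proof.
move=> ET xEE; apply: hnorm2_eq0.
by rewrite hnorm2_symmetric// xEE mul0mx mxE.
Qed.

End HermitianSquares.

(** * Moduli of the roots of real quadratics *)

Section QuadraticRoots.
Variable R : realType.
Implicit Types (z : R[i]) (t q : R).

Lemma quadratic_root_cases z t q : z ^+ 2 - t%:C%C * z + q%:C%C = 0 ->
  (exists2 a, z = a%:C%C & a ^+ 2 - t * a + q = 0) \/
  (cabs z ^+ 2 = q).
Proof.
case: z => x y; rewrite expr2 => /eqP.
rewrite eq_complex /= => /andP[/eqP re /eqP im].
have [y0|y0] := eqVneq y 0.
  by left; exists x; [rewrite y0|rewrite -re y0; ring].
right; rewrite cabs_sqr.
have t2 : t = 2 * x.
  apply/eqP; rewrite -subr_eq0; have /eqP : y * (t - 2 * x) = 0.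
    by rewrite -[RHS]oppr0 -im; ring.
  by rewrite mulf_eq0 (negPf y0).
apply/eqP; rewrite -subr_eq0; apply/eqP; rewrite -[RHS]oppr0 -re t2; ring.
Qed.

Lemma quadratic_root_modulus z t q : t ^+ 2 <= 4 * q ->
  z ^+ 2 - t%:C%C * z + q%:C%C = 0 -> cabs z ^+ 2 = q.
Proof.
move=> tq /quadratic_root_cases[[a -> aE]|//].
rewrite cabs_real real_normK ?num_real//.
have a2 : (2 * a - t) ^+ 2 = t ^+ 2 - 4 * q.
  by transitivity (t ^+ 2 - 4 * q + 4 * (a ^+ 2 - t * a + q));
    [ring|rewrite aE; ring].
have : 2 * a - t = 0.
  apply/eqP; rewrite -sqrf_eq0; apply/eqP/le_anti.
  by rewrite sqr_ge0 a2 subr_le0 tq.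
move=> e; have tE : t = 2 * a by lra.
by move: aE; rewrite tE; lra.
Qed.

(** A real root a with |a| >= 1 would give a^2 + q < (1 + q) |a|, that is
(|a| - 1)(|a| - q) < 0. *)
Lemma quadratic_root_lt1 z t q : 0 <= q < 1 -> `|t| < 1 + q ->
  z ^+ 2 - t%:C%C * z + q%:C%C = 0 -> cabs z < 1.
Proof.
move=> /andP[q0 q1] tq /quadratic_root_cases[[a -> aE]|zq]; last first.
  rewrite ltNge; apply/negP => z1.
  have : 1 <= cabs z ^+ 2 by rewrite expr_ge1// ltW// (lt_le_trans ltr01).
  by rewrite zq; lra.
rewrite cabs_real ltNge; apply/negP => a1.
have : `|a| ^+ 2 + q <= `|t| * `|a|.
  rewrite real_normK ?num_real// -normrM.
  by have := ler_norm (t * a); lra.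
have := normr_ge0 t; nra.
Qed.

End QuadraticRoots.

(** * Spectrum of the operator for alpha = 1 *)

Section ComplexSpectrum.
Variables (R : realType) (n : nat) (P Q : 'M[R]_n).
Hypotheses (PP : P *m P = P) (QQ : Q *m Q = Q) (PT : P^T = P) (QT : Q^T = Q).
Local Notation toC := (map_mx (real_complex R)).
Local Notation refl b := (reflections (toC P) (toC Q) b%:C%C).

Let PPc : toC P *m toC P = toC P. Proof. by rewrite -map_mxM PP. Qed.
Let QQc : toC Q *m toC Q = toC Q. Proof. by rewrite -map_mxM QQ. Qed.

Let toC_sqdiff : sqdiff (toC P) (toC Q) = toC (sqdiff P Q).
Proof. by rewrite /sqdiff map_mxM map_mxB. Qed.

Lemma sqdiff_sym : (sqdiff P Q)^T = sqdiff P Q.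
Proof. by rewrite /sqdiff trmx_mul linearB /= PT QT. Qed.

Lemma row_reflections_quad (b : R) (w : 'rV[R[i]]_n) : let d := 2 * b - 1 in
  w *m refl b *m refl b + (d ^+ 2)%:C%C *: w =
  (1 + d ^+ 2)%:C%C *: (w *m refl b)
    - (4 * b ^+ 2)%:C%C *: (w *m refl b *m toC (sqdiff P Q)).
Proof.
move=> d; have := reflections_quad PPc QQc b%:C%C; rewrite toC_sqdiff.
move: (refl b) => T TT.
rewrite -!mulmxA !(scalemxAr _ w) -mulmxBr -[X in _ + _ *: X](mulmx1 w).
rewrite scalemxAr -mulmxDr; congr (w *m _).
have dE : d%:C%C = 2 * b%:C%C - 1 by rewrite rmorphB rmorphM rmorph_nat rmorph1.
have d2E : (d ^+ 2)%:C%C = (2 * b%:C%C - 1) ^+ 2 by rewrite rmorphXn -dE.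
have b2E : (4 * b ^+ 2)%:C%C = 4 * b%:C%C ^+ 2.
  by rewrite rmorphM rmorph_nat rmorphXn.
have e : (1 + d ^+ 2)%:C%C = 1 + (2 * b%:C%C - 1) ^+ 2.
  by rewrite -d2E -(rmorph1 (real_complex R)) -rmorphD.
by rewrite e d2E b2E; exact: TT.
Qed.

(** The quadratic identity evaluated on an eigenvector x contains D only in the
term 4 b^2 z x D, so x D is a multiple of x. *)
Lemma reflections_eigenvalue (b : R) (z : R[i]) : b != 0 ->
  eigenvalue (refl b) z -> z != 0 ->
  exists s, [/\ 0 <= s <= 1, eigenvalue (sqdiff P Q) s &
    z ^+ 2 - (1 + (2 * b - 1) ^+ 2 - 4 * b ^+ 2 * s)%:C%C * z
      + ((2 * b - 1) ^+ 2)%:C%C = 0].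
Proof.
move=> b0 /eigenvalueP[x xT x0] z0; set d := 2 * b - 1.
have b40 : (4 * b ^+ 2)%:C%C * z != 0.
  by rewrite mulf_neq0// fmorph_eq0 mulf_neq0 ?expf_neq0// pnatr_eq0.
pose l := ((1 + d ^+ 2)%:C%C * z - z ^+ 2 - (d ^+ 2)%:C%C)
            / ((4 * b ^+ 2)%:C%C * z).
have xD : x *m toC (sqdiff P Q) = l *: x.
  apply: (scalerI b40); rewrite scalerA [X in X *: x]mulrC /l divfK//.
  have := row_reflections_quad b x; rewrite xT -!scalemxAl xT !scalerA.
  rewrite !scalerBl -expr2 => /eqP; rewrite eq_sym subr_eq => /eqP e.
  apply/eqP; rewrite -addrA -opprD eq_sym subr_eq; apply/eqP.
  by rewrite -scalerA [RHS]addrC; exact: e.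
have [s s0 ls] : exists2 s : R, 0 <= s & l = s%:C%C.
  by apply: symmetric_square_eigenvalue x0 xD; rewrite linearB /= PT QT.
have [s' s'0 ls'] : exists2 s : R, 0 <= s & 1 - l = s%:C%C.
  apply: (@symmetric_square_eigenvalue _ _ (1%:M - P - Q) x) => //.
    by rewrite !linearB /= PT QT trmx1.
  by rewrite -sqdiff_compl// map_mxB map_mx1 mulmxBr mulmx1 xD scalerBl scale1r.
have s1 : s <= 1.
  move: ls'; rewrite ls -(rmorph1 (real_complex R)) -rmorphB => /complexI; lra.
exists s; split; first by rewrite s0.
  rewrite -(eigenvalue_map (real_complex R)); apply/eigenvalueP.
  by exists x => //; rewrite xD ls.
have := ls; rewrite /l => /(canRL (divfK b40)) e.
have -> : (1 + d ^+ 2 - 4 * b ^+ 2 * s)%:C%C =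
    (1 + d ^+ 2)%:C%C - (4 * b ^+ 2)%:C%C * s%:C%C :> R[i].
  by rewrite rmorphB (rmorphM _ (4 * b ^+ 2)).
move: e; move: (1 + d ^+ 2)%:C%C (4 * b ^+ 2)%:C%C (d ^+ 2)%:C%C s%:C%C.
move=> t p q r e; transitivity (r * (p * z) - (t * z - z ^+ 2 - q)); first by ring.
by rewrite e subrr.
Qed.

(** For y (R - 1)^2 = 0 put z = y (R - 1), so that z R = z.  The identity in the
form (R - 1)(R - d^2) = - 4 b^2 R D gives z D = 0 when applied to z, and
(1 - d^2) z = - 4 b^2 y D when applied to y.  So z is in the kernel and in the
image of the symmetric matrix D, and z = 0.  The factor a makes the statement
cover the averaged operators. *)
Lemma reflections_semisimple (a b : R) : a != 0 -> 0 < b < 1 ->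
  forall y : 'rV[R[i]]_n,
  let A := a%:C%C *: (refl b - 1%:M) in
  y *m A *m A = 0 -> y *m A = 0.
Proof.
move=> a0 /andP[b0 b1] y A.
have aC : a%:C%C != 0 by rewrite fmorph_eq0.
rewrite /A -!scalemxAr -scalemxAl => /eqP.
rewrite !scalemx_eq0 (negPf aC)/= => /eqP.
set z := y *m _ => zT; suff -> : z = 0 by rewrite scaler0.
set d := 2 * b - 1; set D := toC (sqdiff P Q).
have zE : z *m refl b = z.
  by apply/subr0_eq; rewrite -zT mulmxBr mulmx1.
have yE : y *m refl b = y + z by rewrite /z mulmxBr mulmx1 addrC subrK.
have d1E : (1 + d ^+ 2)%:C%C = 1 + (d ^+ 2)%:C%C :> R[i].
  by rewrite -[X in _ = X + _](rmorph1 (real_complex R)) -rmorphD.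
have quad (w : 'rV[R[i]]_n) : w *m refl b *m refl b + (d ^+ 2)%:C%C *: w =
    (1 + (d ^+ 2)%:C%C) *: (w *m refl b)
    - (4 * b ^+ 2)%:C%C *: (w *m refl b *m D).
  by rewrite -d1E; exact: row_reflections_quad.
have b4 : (4 * b ^+ 2)%:C%C != 0 :> R[i].
  by rewrite fmorph_eq0 mulf_neq0 ?expf_neq0 ?pnatr_eq0// gt_eqF.
have zD : z *m D = 0.
  apply: (scalerI b4); rewrite scaler0.
  have := quad z; rewrite !zE scalerDl scale1r.
  by move=> /(congr1 (fun M => z + (d ^+ 2)%:C%C *: z - M)); rewrite subrr subKr.
have d1 : (1 - d ^+ 2)%:C%C != 0 :> R[i].
  by rewrite fmorph_eq0; apply/eqP; rewrite /d; nra.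
have zyD : (1 - d ^+ 2)%:C%C *: z = - (4 * b ^+ 2)%:C%C *: (y *m D).
  have := quad y; rewrite yE !mulmxDl zE yE zD addr0.
  have -> : (1 - d ^+ 2)%:C%C = 1 - (d ^+ 2)%:C%C :> R[i].
    by rewrite -[X in _ = X - _](rmorph1 (real_complex R)) -rmorphB.
  move=> /eqP; rewrite -subr_eq0 => /eqP e.
  apply/eqP; rewrite -subr_eq0 -e; apply/eqP.
  by apply/matrixP => i j; rewrite !mxE; ring.
have yD : y *m D = 0.
  apply: symmetric_square_kernel; first exact: sqdiff_sym.
  apply: (scalerI b4); rewrite scaler0 scalemxAl; apply: oppr_inj.
  by rewrite -mulNmx -scaleNr -zyD -scalemxAl zD scaler0 oppr0.
by apply: (scalerI d1); rewrite zyD yD !scaler0.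
Qed.

End ComplexSpectrum.

(** * The optimization over the parameters *)

Section Inequalities.
Variable R : realType.
Implicit Types s b a : R.

(** Half the trace, and a square root of the determinant, of the block of the
Friedrichs angle with sine s. *)
Local Notation hx b s := (2 * b ^+ 2 * (1 - s ^+ 2) - 2 * b + 1).
Local Notation dl b := (2 * b - 1).
Local Notation opt s := ((1 - s) / (1 + s)).

Lemma block_disc b s : hx b s ^+ 2 - dl b ^+ 2 =
  4 * b ^+ 2 * (1 - s ^+ 2) * (1 - b * (1 + s)) * (1 - b + b * s).
Proof. ring. Qed.

(** Let m be the optimal value and p the characteristic polynomial.  If the
larger root were below m, then p(m) > 0 and m > x, where x is half the trace.
But p(m) > 0 confines b to b (1 + s) < s, for which x >= 1 - 2 b > m. *)
Lemma opt_le_real_root s b : 0 < s <= 1 -> 0 < b -> b * (1 + s) <= 1 ->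
  0 <= hx b s ^+ 2 - dl b ^+ 2 /\
  opt s <= hx b s + Num.sqrt (hx b s ^+ 2 - dl b ^+ 2).
Proof.
move=> /andP[s0 s1] b0 bs.
have disc0 : 0 <= hx b s ^+ 2 - dl b ^+ 2.
  rewrite block_disc !mulr_ge0//; nra.
split=> //; set x := hx b s in disc0 *.
have s1_gt0 : 0 < 1 + s by lra.
rewrite leNgt; apply/negP => lt.
have r0 := sqrtr_ge0 (x ^+ 2 - dl b ^+ 2).
have r2 := sqr_sqrtr disc0.
set r := Num.sqrt _ in lt r0 r2.
set m := opt s in lt.
have mE : m * (1 + s) = 1 - s by rewrite /m divfK// gt_eqF.
have pm : 0 < m ^+ 2 - 2 * x * m + dl b ^+ 2.
  have : 0 < (m - x - r) * (m - x + r) by apply: mulr_gt0; lra.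
  by nra.
have pmE : (m ^+ 2 - 2 * x * m + dl b ^+ 2) * (1 + s) ^+ 2 =
    4 * s * (b * (1 + s) - 1) * ((2 - s) * (b * (1 + s)) - s).
  transitivity ((m * (1 + s)) ^+ 2 - 2 * x * (m * (1 + s)) * (1 + s)
    + dl b ^+ 2 * (1 + s) ^+ 2); first by ring.
  by rewrite mE /x; ring.
have bsmall : b * (1 + s) < s.
  have : 0 < (m ^+ 2 - 2 * x * m + dl b ^+ 2) * (1 + s) ^+ 2.
    by rewrite mulr_gt0// exprn_gt0.
  rewrite pmE => pos.
  have h : (2 - s) * (b * (1 + s)) < s.
    rewrite ltNge; apply/negP => ge; move: pos; rewrite ltNge => /negP; apply.
    rewrite mulr_le0_ge0//; last by rewrite subr_ge0.
    by rewrite mulr_ge0_le0//; lra.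
  by apply: le_lt_trans h; rewrite ler_peMl//; [nra|lra].
have : 1 - 2 * b < m.
  apply: le_lt_trans lt; apply: (@le_trans _ _ x); last by rewrite lerDl.
  have : 0 <= b ^+ 2 * (1 - s ^+ 2) by rewrite mulr_ge0 ?sqr_ge0//; nra.
  by rewrite /x; lra.
by rewrite -(ltr_pM2r s1_gt0) mE; nra.
Qed.

(** The squared modulus of 1 - a + a z is quadratic in a.  If
b (1 + s^2) <= 1, its minimum over [0, 1] is at a = 1, where it is d^2, at least
m^2.  Otherwise its minimum is g0 = k (2b - 1 - b^2 k) / s^2 with
k = 1 - s^2, which increases in b from its value (k / (1 + s^2))^2 at
b = 1 / (1 + s^2), and k / (1 + s^2) >= m. *)
Lemma opt_le_complex_root s b a : 0 < s <= 1 -> b < 1 -> 1 < b * (1 + s) ->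
  0 <= a <= 1 ->
  0 <= dl b ^+ 2 - hx b s ^+ 2 /\
  opt s ^+ 2 <= (1 - a + a * hx b s) ^+ 2 + a ^+ 2 * (dl b ^+ 2 - hx b s ^+ 2).
Proof.
move=> /andP[s0 s1] b1 bs /andP[a0 a1].
have b0 : 0 < b by nra.
split.
  rewrite -opprB oppr_ge0 block_disc mulr_le0_ge0//; last by nra.
  by rewrite mulr_ge0_le0//; [rewrite !mulr_ge0 ?sqr_ge0//; nra|lra].
have s1_gt0 : 0 < 1 + s by lra.
set m := opt s; have mE : m * (1 + s) = 1 - s by rewrite /m divfK// gt_eqF.
have m0 : 0 <= m by rewrite divr_ge0//; lra.
have [bs2|bs2] := leP (b * (1 + s ^+ 2)) 1.
  have md : m <= dl b.
    by rewrite -(ler_pM2r s1_gt0) mE; lra.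
  apply: (@le_trans _ _ (dl b ^+ 2)).
    by rewrite ler_pXn2r ?nnegrE//; lra.
  rewrite -subr_ge0.
  have -> : (1 - a + a * hx b s) ^+ 2 + a ^+ 2 * (dl b ^+ 2 - hx b s ^+ 2)
      - dl b ^+ 2 = (1 - a) ^+ 2 * (4 * b ^+ 2 * s ^+ 2)
      + 2 * (1 - a) * (2 * b * (1 - b * (1 + s ^+ 2))).
    ring.
  rewrite addr_ge0// !mulr_ge0 ?sqr_ge0//; lra.
have bk : b * (1 - s ^+ 2) <= 1 by nra.
have k_pos : 0 < 1 + s ^+ 2 by have := sqr_ge0 s; lra.
have s2_gt0 : 0 < s ^+ 2 by rewrite exprn_gt0.
pose k := 1 - s ^+ 2.
have k0 : 0 <= k by rewrite /k; nra.
pose g0 := k * (2 * b - 1 - b ^+ 2 * k) / s ^+ 2.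
have -> : (1 - a + a * hx b s) ^+ 2 + a ^+ 2 * (dl b ^+ 2 - hx b s ^+ 2) =
    (2 * a * b * s - (1 - hx b s) / (2 * b * s)) ^+ 2 + g0.
  by rewrite /g0 /k; field; rewrite !gt_eqF.
apply: (@le_trans _ _ g0); last by rewrite lerDr sqr_ge0.
pose m1 := k / (1 + s ^+ 2).
have m1E : m1 * (1 + s ^+ 2) = k by rewrite /m1 divfK// gt_eqF.
apply: (@le_trans _ _ (m1 ^+ 2)).
  rewrite ler_pXn2r ?nnegrE// ?(divr_ge0 k0 (ltW k_pos))//.
  rewrite ler_pdivlMr// mulrAC ler_pdivrMr// /k.
  by nra.
rewrite /g0 ler_pdivlMr// -(ler_pM2r (exprn_gt0 2 k_pos)).
have -> : m1 ^+ 2 * s ^+ 2 * (1 + s ^+ 2) ^+ 2 = k * (k * s ^+ 2).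
  transitivity ((m1 * (1 + s ^+ 2)) ^+ 2 * s ^+ 2); first by ring.
  by rewrite m1E; ring.
rewrite -mulrA ler_wpM2l// -subr_ge0.
have -> : (2 * b - 1 - b ^+ 2 * k) * (1 + s ^+ 2) ^+ 2 - k * s ^+ 2 =
    (b * (1 + s ^+ 2) - 1) * (1 + s ^+ 2 + (1 + s ^+ 2) * (1 - b * k) - k).
  by rewrite /k; ring.
by rewrite mulr_ge0//; rewrite /k in bk *; nra.
Qed.

End Inequalities.

(** * The averaged operators *)

Section AAMRSpectrum.
Variables (R : realType) (n : nat) (U V : {vspace 'cV[R]_n.+1}).
Local Notation P := (projector U).
Local Notation Q := (projector V).
Local Notation c := (friedrichs_cos U V).
Local Notation s := (Num.sqrt (1 - friedrichs_cos U V ^+ 2)).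
Local Notation toC := (map_mx (real_complex R)).
Local Notation refl b := (reflections (toC P) (toC Q) b%:C%C).
Local Notation T a b := (complexify (aamr a b U V)).
Local Notation opt := ((1 - s) / (1 + s)).
Local Notation bopt := (1 / (1 + s)).

Let PP : P *m P = P. Proof. exact: projector_idem. Qed.
Let QQ : Q *m Q = Q. Proof. exact: projector_idem. Qed.
Let PT : P^T = P. Proof. exact: projector_sym. Qed.
Let QT : Q^T = Q. Proof. exact: projector_sym. Qed.

Let cc1 : 0 <= c ^+ 2 < 1.
Proof.
have := friedrichs_cos_ge0 U V; have := friedrichs_cos_lt1 U V.
by rewrite sqr_ge0 /=; nra.
Qed.

Let ss : s ^+ 2 = 1 - c ^+ 2.
Proof. by rewrite sqr_sqrtr//; case/andP: cc1; lra. Qed.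

Let s01 : 0 < s <= 1.
Proof.
have [? ?] := andP cc1; rewrite sqrtr_gt0 -[leRHS](sqrtr1 R) ler_sqrt ?ler01//.
by apply/andP; split; lra.
Qed.

Let bopt01 : 0 < bopt < 1.
Proof.
have [s0 s1] := andP s01; have sp : 0 < 1 + s by lra.
by apply/andP; split; [rewrite divr_gt0//|rewrite ltr_pdivrMr//]; lra.
Qed.

Lemma complexify_aamr a b :
  T a b = (1 - a)%:C%C *: 1%:M + a%:C%C *: refl b.
Proof.
rewrite /complexify /aamr /reflections map_mxD !map_mxZ map_mx1 map_mxM.
by rewrite !map_mxB !map_mxZ map_mx1 rmorphM rmorph_nat.
Qed.

Lemma complexify_aamrB1 a b : T a b - 1%:M = a%:C%C *: (refl b - 1%:M).
Proof.
rewrite complexify_aamr rmorphB rmorph1.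
by apply/matrixP => i j; rewrite !mxE; ring.
Qed.

Lemma aamr_semisimple a b : 0 < a -> 0 < b < 1 -> semisimple_at1 (T a b).
Proof.
move=> a0 b01 y; rewrite [T a b - 1]complexify_aamrB1.
by apply: reflections_semisimple => //; rewrite gt_eqF.
Qed.

Lemma aamr_eigenvalue a b z :
  eigenvalue (refl b) z -> eigenvalue (T a b) ((1 - a)%:C%C + a%:C%C * z).
Proof.
move=> /eigenvalueP[x xT x0]; apply/eigenvalueP; exists x => //.
by rewrite complexify_aamr mulmxDr -!scalemxAr mulmx1 xT scalerA -scalerDl.
Qed.

Lemma aamr_eigenvalue_inv a b l : a != 0 -> eigenvalue (T a b) l ->
  exists2 z, eigenvalue (refl b) z & l = (1 - a)%:C%C + a%:C%C * z.
Proof.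
move=> a0 /eigenvalueP[x xT x0].
have aC : a%:C%C != 0 :> R[i] by rewrite fmorph_eq0.
exists ((l - (1 - a)%:C%C) / a%:C%C); last by rewrite mulrC divfK// addrC subrK.
apply/eigenvalueP; exists x => //; apply: (scalerI aC).
rewrite scalerA [a%:C%C * _]mulrC divfK// scalerBl -xT complexify_aamr.
by rewrite mulmxDr -!scalemxAr mulmx1 addrC addKr.
Qed.

(** An eigenvalue is a convex combination of 1 and an eigenvalue z of the
operator for a = 1, and z = 1 or |z| < 1. *)
Lemma aamr_gamma_lt1 (a b : R) : 0 < a <= 1 -> 0 < b < 1 -> gamma (T a b) < 1.
Proof.
move=> /andP[a0 a1] /andP[b0 b1].
have an0 : a != 0 by rewrite gt_eqF.
have [[l lT ->] _] := gamma_max (T a b).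
case: lT => [->|[/(aamr_eigenvalue_inv an0)[z zT lE] l1]]; first by rewrite cabs0.
have zlt1 : cabs z < 1.
  have [->|z0] := eqVneq z 0; first by rewrite cabs0.
  have [|r [/andP[r0 r1] _ zE]] := reflections_eigenvalue PP QQ PT QT _ zT z0.
    by rewrite gt_eqF.
  have d1 : 0 <= (2 * b - 1) ^+ 2 < 1 by rewrite sqr_ge0 /=; nra.
  have [r_eq0|r_neq0] := eqVneq r 0.
    have : (z - 1) * (z - ((2 * b - 1) ^+ 2)%:C%C) = 0.
      by rewrite -[RHS]zE r_eq0 mulr0 subr0 rmorphD rmorph1; ring.
    move=> /eqP; rewrite mulf_eq0 !subr_eq0 => /orP[/eqP z1|/eqP ->].
      by case: l1; rewrite lE z1 mulr1 rmorphB rmorph1 subrK.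
    by rewrite cabs_real ger0_norm; case/andP: d1.
  apply: quadratic_root_lt1 d1 _ zE.
  have r_gt0 : 0 < r by rewrite lt_def r_neq0.
  have b2 : 0 < b ^+ 2 by rewrite exprn_gt0.
  by rewrite ltr_norml; apply/andP; split; nra.
rewrite lE; apply: le_lt_trans (cabsD _ _) _.
rewrite cabsM !cabs_real !ger0_norm ?subr_ge0 ?(ltW a0)//.
by have := cabs_ge0 z; nra.
Qed.

(** With b = 1 / (1 + s) the trace term 1 + d^2 - 4 b^2 r is
(2 + 2 s^2 - 4 r) / (1 + s)^2.  For r between s^2 and 1 its modulus is at most
2 d, so the roots have modulus d. *)
Lemma aamr_opt_gamma_le : gamma (T 1 bopt) <= opt.
Proof.
have [s0 s1] := andP s01.
have sp : 0 < 1 + s by lra.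
have opt0 : 0 <= opt by rewrite divr_ge0//; lra.
have dE : 2 * bopt - 1 = opt by field; rewrite gt_eqF.
have opt1 : opt <= 1 by rewrite ler_pdivrMr//; lra.
have [[l lT ->] _] := gamma_max (T 1 bopt).
case: lT => [->|[/(aamr_eigenvalue_inv (oner_neq0 R))[z zT lE] l1]].
  by rewrite cabs0.
have lz : l = z by rewrite lE subrr add0r mul1r.
rewrite {}lz {lE} in l1 *.
have [->|z0] := eqVneq z 0; first by rewrite cabs0.
have bn0 : bopt != 0 by rewrite div1r invr_eq0 gt_eqF.
have [r [/andP[r0 r1] rD zE]] := reflections_eigenvalue PP QQ PT QT bn0 zT z0.
have [r_eq0|r_neq0] := eqVneq r 0.
  have : (z - 1) * (z - ((2 * bopt - 1) ^+ 2)%:C%C) = 0.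
    have e : (1 + (2 * bopt - 1) ^+ 2)%:C%C
        = 1 + ((2 * bopt - 1) ^+ 2)%:C%C :> R[i].
      by rewrite -[X in _ = X + _](rmorph1 (real_complex R)) -rmorphD.
    by rewrite -[RHS]zE r_eq0 mulr0 subr0 e; ring.
  move=> /eqP; rewrite mulf_eq0 !subr_eq0 => /orP[/eqP z1|/eqP ->].
    by case: l1.
  by rewrite dE cabs_real ger0_norm ?sqr_ge0// expr2 ler_piMl.
have gap : s ^+ 2 <= r.
  have /eigenvalueP[y yD y0] := rD.
  rewrite ss; apply: (@sqdiff_spectral_gap _ _ U V y^T) => //.
    by apply: contraNN y0 => /eqP y0; rewrite -(trmxK y) y0 trmx0.
  by rewrite -(sqdiff_sym PT QT) -trmx_mul yD linearZ.
suff : cabs z ^+ 2 = opt ^+ 2.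
  by move=> /eqP; rewrite eqrXn2 ?cabs_ge0// => /eqP ->.
rewrite dE in zE; apply: quadratic_root_modulus zE.
have -> : 1 + opt ^+ 2 - 4 * bopt ^+ 2 * r
    = (2 + 2 * s ^+ 2 - 4 * r) / (1 + s) ^+ 2 by field; rewrite gt_eqF.
have -> : 4 * opt ^+ 2 = (2 - 2 * s ^+ 2) ^+ 2 / ((1 + s) ^+ 2) ^+ 2.
  by field; rewrite gt_eqF.
rewrite expr_div_n ler_pM2r ?invr_gt0 ?exprn_gt0//.
by rewrite -subr_ge0 subr_sqr mulr_ge0//; lra.
Qed.

(** The singular vectors for c, as rows: the operator acts on rows from the
right, as in the definition of eigenvalues. *)
Lemma principal_rows : 0 < c -> exists u v : 'rV[R[i]]_n.+1,
  [/\ v != 0, u *m toC P = u, u *m toC Q = (c ^+ 2)%:C%C *: v,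
      v *m toC P = u & v *m toC Q = v].
Proof.
move=> c0; have [v [v0 Qv _ QPv]] := friedrichs_vector c0.
exists (toC (v^T *m P)), (toC v^T); split.
- rewrite map_mx_eq0; apply: contraNN v0 => /eqP v0.
  by rewrite -(trmxK v) v0 trmx0.
- by rewrite -map_mxM -mulmxA PP.
- rewrite -map_mxM -map_mxZ; congr map_mx.
  by rewrite -[RHS]linearZ /= -QPv !trmx_mul PT QT mulmxA.
- by rewrite map_mxM.
- by rewrite -map_mxM; congr map_mx; rewrite -{1}QT -trmx_mul Qv.
Qed.

Let kC : 0 < c -> (c ^+ 2)%:C%C != 0 :> R[i] /\ (c ^+ 2)%:C%C != 1 :> R[i].
Proof.
move=> c0; split; first by rewrite fmorph_eq0 expf_neq0 ?gt_eqF.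
rewrite -(rmorph1 (real_complex R)) (inj_eq (@complexI R)) lt_eqF//.
by case/andP: cc1.
Qed.

(** The block of the principal vectors has a real root if b (1 + s) <= 1 and a
pair of conjugate roots otherwise.  For c = 0 the bound is 0. *)
Lemma aamr_opt_le_gamma (a b : R) : 0 < a <= 1 -> 0 < b < 1 -> opt <= gamma (T a b).
Proof.
move=> /andP[a0 a1] /andP[b0 b1]; have [_ gT] := gamma_max (T a b).
have [c_eq0|c_neq0] := eqVneq c 0.
  rewrite c_eq0 expr0n subr0 sqrtr1 subrr mul0r -(@cabs0 R).
  by apply: gT; left.
have c0 : 0 < c by rewrite lt_def c_neq0 friedrichs_cos_ge0.
have [u [v [v0 uP uQ vP vQ]]] := principal_rows c0.
have [k0 k1] := kC c0.
have [s0 s1] := andP s01.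
set x := 2 * b ^+ 2 * (1 - s ^+ 2) - 2 * b + 1.
have xE : 2 * b ^+ 2 * c ^+ 2 - 2 * b + 1 = x by rewrite /x ss subKr.
suff [z zE zopt] : exists2 z : R[i],
    z ^+ 2 - (2 * x)%:C%C * z + ((2 * b - 1) ^+ 2)%:C%C = 0 &
    opt <= cabs ((1 - a)%:C%C + a%:C%C * z).
  apply: le_trans zopt _; apply: gT; right; split.
    apply: aamr_eigenvalue; apply/eigenvalueP.
    apply: (block_eigen uP uQ vP vQ) => //.
      by rewrite fmorph_eq0 gt_eqF.
    rewrite -[RHS]zE -xE.
    have -> : (2 * (2 * b ^+ 2 * c ^+ 2 - 2 * b + 1))%:C%C
        = 4 * b%:C%C ^+ 2 * (c ^+ 2)%:C%C - 2 * (2 * b%:C%C - 1) :> R[i].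
      have -> : 2 * (2 * b ^+ 2 * c ^+ 2 - 2 * b + 1) =
        4 * b ^+ 2 * c ^+ 2 - 2 * (2 * b - 1) by ring.
      rewrite rmorphB; congr (_ - _).
        by rewrite rmorphM; congr (_ * _); rewrite rmorphM rmorph_nat rmorphXn.
      by rewrite rmorphM rmorph_nat rmorphB rmorphM rmorph_nat rmorph1.
    by congr (_ + _); rewrite rmorphXn rmorphB rmorphM rmorph_nat rmorph1.
  move=> l1.
  have z1 : z = 1.
    have aC : a%:C%C != 0 :> R[i] by rewrite fmorph_eq0 gt_eqF.
    apply: (mulfI aC); rewrite mulr1; apply: (addrI (1 - a)%:C%C).
    by rewrite l1 -rmorphD subrK rmorph1.
  move: zE; rewrite z1 expr1n mulr1 -(rmorph1 (real_complex R)) -rmorphB -rmorphD.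
  rewrite -[RHS](rmorph0 (real_complex R)) => /complexI.
  have : 0 < b ^+ 2 * s ^+ 2 by rewrite mulr_gt0 ?exprn_gt0.
  by rewrite /x; lra.
have [bs|bs] := leP (b * (1 + s)) 1.
  have [disc optz] := opt_le_real_root s01 b0 bs.
  rewrite -/x in disc optz; set r := Num.sqrt (x ^+ 2 - (2 * b - 1) ^+ 2) in optz.
  have r2 : r ^+ 2 = x ^+ 2 - (2 * b - 1) ^+ 2 by rewrite sqr_sqrtr.
  exists (x + r)%:C%C.
    rewrite -rmorphXn -rmorphM -rmorphB -rmorphD.
    have -> : (x + r) ^+ 2 - 2 * x * (x + r) + (2 * b - 1) ^+ 2
        = r ^+ 2 - (x ^+ 2 - (2 * b - 1) ^+ 2) by ring.
    by rewrite r2 subrr.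
  rewrite -rmorphM -rmorphD cabs_real; apply: le_trans (ler_norm _).
  have : opt <= 1 by rewrite ler_pdivrMr//; lra.
  by nra.
have a01 : 0 <= a <= 1 by rewrite a1 ltW.
have [disc optz] := opt_le_complex_root s01 b1 bs a01.
rewrite -/x in disc optz.
set r := Num.sqrt ((2 * b - 1) ^+ 2 - x ^+ 2).
have r2 : r ^+ 2 = (2 * b - 1) ^+ 2 - x ^+ 2 by rewrite sqr_sqrtr.
exists (Complex x r).
  apply/eqP; rewrite expr2 eq_complex /=; apply/andP; split; apply/eqP.
    have -> : (2 * b - 1) ^+ 2 = r ^+ 2 + x ^+ 2 by rewrite r2 subrK.
    ring.
  ring.
have -> : (1 - a)%:C%C + a%:C%C * Complex x r = Complex (1 - a + a * x) (a * r).
  by apply/eqP; rewrite eq_complex /=; apply/andP; split; apply/eqP; ring.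
rewrite -(@ler_pXn2r _ 2)// ?nnegrE ?cabs_ge0//; last by rewrite divr_ge0//; lra.
by rewrite cabs_sqr [(a * r) ^+ 2]exprMn r2.
Qed.

Lemma aamr_opt_gamma : gamma (T 1 bopt) = opt.
Proof.
apply/eqP; rewrite eq_le aamr_opt_gamma_le aamr_opt_le_gamma//.
by rewrite ltr01 lexx.
Qed.

Lemma aamr_opt_rate_neg : 0 < c -> ~ linear_rates (T 1 bopt) opt.
Proof.
move=> c0; have [s0 s1] := andP s01; have [c2_ge0 c2_lt1] := andP cc1.
have [u [v [v0 uP uQ vP vQ]]] := principal_rows c0.
have [k0 k1] := kC c0.
have sp : 0 < 1 + s by lra.
have c2_gt0 : 0 < c ^+ 2 by rewrite exprn_gt0.
have slt1 : s < 1 by rewrite ltNge; apply/negP => ?; have := ss; nra.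
have TE : T 1 bopt = refl bopt.
  by rewrite complexify_aamr subrr scale0r add0r scale1r.
have d01 : 0 < opt < 1.
  by apply/andP; split; [rewrite divr_gt0//|rewrite ltr_pdivrMr//]; lra.
have bk : bopt ^+ 2 * c ^+ 2 = opt.
  transitivity (bopt ^+ 2 * (1 - s ^+ 2)); first by rewrite ss subKr.
  by field; rewrite gt_eqF.
have dE : 2 * bopt%:C%C - 1 = opt%:C%C.
  have toCd (t : R) : (2 * t - 1)%:C%C = 2 * t%:C%C - 1.
    by rewrite rmorphB rmorphM rmorph_nat rmorph1.
  by rewrite -toCd; congr (_%:C%C); field; rewrite gt_eqF.
have bkC : bopt%:C%C ^+ 2 * (c ^+ 2)%:C%C = 2 * bopt%:C%C - 1 :> R[i].
  have toCM (t r : R) : (t ^+ 2 * r)%:C%C = t%:C%C ^+ 2 * r%:C%C.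
    by rewrite rmorphM; congr (_ * _); rewrite rmorphXn.
  by rewrite dE -bk toCM.
have [uT wT] := block_jordan uP uQ vP vQ bkC.
have := @block_generalized_neq0 _ _ _ _ _ _ _ bopt%:C%C uP uQ vP vQ v0 k0 k1.
rewrite dE in uT wT *; rewrite TE => w0.
apply: (jordan_block_not_rate d01 (w0 _) uT wT).
by have [d0 _] := andP d01; rewrite mulf_neq0 ?pnatr_eq0// fmorph_eq0 gt_eqF.
Qed.

(** For c = 0 the norm of P Q - W is 0, so P and Q commute and the operator for
a = 1, b = 1/2 is the product of the commuting projectors 1 - Q and
1 - P. *)
Lemma aamr_opt_rate0 : c = 0 -> linear_rates (T 1 (1 / 2)) 0.
Proof.
move=> c0; have PQ := mul_projectors_orthogonal c0.
have QP : Q *m P = P *m Q.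
  by rewrite PQ -(projector_sym (U :&: V)) -PQ trmx_mul PT QT.
have idemB (A : 'M[R]_n.+1) : A *m A = A ->
    (A - 1%:M) *m (A - 1%:M) = - (A - 1%:M).
  move=> AA; rewrite mulmxBl !mulmxBr !mulmx1 mul1mx AA.
  by rewrite subrr sub0r.
have BA : (P - 1%:M) *m (Q - 1%:M) = (Q - 1%:M) *m (P - 1%:M).
  rewrite !mulmxBl !mulmxBr !mulmx1 !mul1mx QP.
  by apply/matrixP => i j; rewrite !mxE; ring.
have TE : aamr 1 (1 / 2) U V = (Q - 1%:M) *m (P - 1%:M).
  rewrite /aamr subrr scale0r add0r scale1r mulrC divfK ?pnatr_eq0//.
  by rewrite !scale1r.
have TT : T 1 (1 / 2) * T 1 (1 / 2) = T 1 (1 / 2).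
  rewrite /complexify -[LHS]map_mxM TE; congr map_mx.
  rewrite mulmxA -(mulmxA _ (P - 1%:M)) BA mulmxA idemB// -mulmxA idemB//.
  by rewrite mulNmx mulmxN opprK.
exists (T 1 (1 / 2)); split; first by rewrite lexx ltr01.
exists 1%N, 1; split=> // k k1.
have -> : T 1 (1 / 2) ^+ k = T 1 (1 / 2).
  case: k k1 => // k _; elim: k => [|k IH]; first by rewrite expr1.
  by rewrite exprS IH TT.
by rewrite subrr opnorm0 mul1r exprn_ge0.
Qed.

Lemma sin_friedrichs_angle : sin (friedrichs_angle U V) = s.
Proof.
apply: sin_acos; have := friedrichs_cos_ge0 U V; have := friedrichs_cos_lt1 U V.
by move=> *; apply/andP; lra.
Qed.

Lemma friedrichs_angle_pihalf : friedrichs_angle U V = pi / 2 <-> c = 0.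
Proof.
split=> [th|c0]; last by rewrite /friedrichs_angle c0 acos0.
by have [_ <-] := cos_friedrichs_angle U V; rewrite th cos_pihalf.
Qed.

Lemma inf_aamr_rates (a b : R) : 0 < a <= 1 -> 0 < b < 1 ->
  linear_rates (T a b) !=set0 /\ inf (linear_rates (T a b)) = gamma (T a b).
Proof.
move=> a01 b01; apply: inf_linear_rates; last exact: aamr_gamma_lt1.
by apply: aamr_semisimple => //; case/andP: a01.
Qed.

Lemma aamr_optimum :
  [/\ 0 < bopt < 1,
      opt = gamma (T 1 bopt),
      forall a b : R, 0 < a <= 1 -> 0 < b < 1 ->
        gamma (T 1 bopt) <= gamma (T a b) &
      optimal_rate (T 1 bopt) (gamma (T 1 bopt)) <-> c = 0].
Proof.
rewrite aamr_opt_gamma; split; [exact: bopt01|by []|exact: aamr_opt_le_gamma|].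
have a01 : 0 < (1 : R) <= 1 by rewrite ltr01 lexx.
have [_ infE] := inf_aamr_rates a01 bopt01.
rewrite /optimal_rate infE aamr_opt_gamma; split=> [[ratem _]|c0].
  apply/eqP; have [//|c_neq0] := eqVneq c 0.
  by case: aamr_opt_rate_neg => //; rewrite lt_def c_neq0 friedrichs_cos_ge0.
split=> //; rewrite c0 expr0n subr0 sqrtr1 subrr mul0r.
exact: aamr_opt_rate0.
Qed.

End AAMRSpectrum.

(** * Optimal parameters *)

Unset Implicit Arguments.

Theorem theorem3p2 (R : realType) (n : nat) (U V : {vspace 'cV[R]_n})
  (dimU : (1 <= \dim U)%N) (dimUV : (\dim U <= \dim V)%N)
  (dimV : (\dim V <= n - 1)%N)
  (UneqUV : U <> (U :&: V)%VS) (UVneq0 : (U :&: V)%VS <> 0%VS) :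
  let theta := friedrichs_angle U V in
  let beta_star := 1 / (1 + sin theta) in
  let T := fun alpha beta : R => complexify (aamr alpha beta U V) in
  [/\ 0 < beta_star < 1,
      forall alpha beta : R, 0 < alpha <= 1 -> 0 < beta < 1 ->
        linear_rates (T alpha beta) !=set0 /\
        inf (linear_rates (T 1 beta_star)) <= inf (linear_rates (T alpha beta)),
      (1 - sin theta) / (1 + sin theta) = gamma (T 1 beta_star),
      forall alpha beta : R, 0 < alpha <= 1 -> 0 < beta < 1 ->
        gamma (T 1 beta_star) <= gamma (T alpha beta) &
      optimal_rate (T 1 beta_star) (gamma (T 1 beta_star)) <->
        theta = pi / 2].
Proof.
case: n U V dimU dimUV dimV UneqUV UVneq0 => [|n] U V dimU dimUV dimV _ _.
  by move: (leq_trans dimU (leq_trans dimUV dimV)).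
move=> theta beta_star T.
have [b01 gE gmin opt] := aamr_optimum U V.
rewrite -(sin_friedrichs_angle U V) in b01 gE gmin opt.
have a01 : 0 < (1 : R) <= 1 by rewrite ltr01 lexx.
split; [exact: b01| |exact: gE|exact: gmin|].
  move=> alpha beta a_in b_in.
  have [ne infab] := inf_aamr_rates U V a_in b_in.
  have [_ inf1] := inf_aamr_rates U V a01 b01.
  split; first exact: ne.
  by rewrite [leLHS]inf1 [leRHS]infab; exact: gmin.
exact: iff_trans opt (iff_sym (friedrichs_angle_pihalf U V)).
Qed.
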